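(* Let $X$ be a set, let $\mathcal F\subset\mathbb R^X$ be pointwise bounded and let $g\in\mathbb R^X$. Then $g\in\mathcal S_{\mathcal F}(X)$ if and only if $$|g(x)|\le C_g\int_{\mathcal F}|f(x)|\,m_g(df)\qquad\text{for all }x\in X$$ for some $C_g\ge0$ and $m_g\in\mathbb P(\mathcal F;\mathcal E(X))$. If $\mathcal F$ is $X$-closed then $m_g$ may be chosen to be a regular Borel probability on $\mathscr B_X(\mathcal F)$.
   Context: All underlying sets on which functions or probabilities are considered are non-empty. $\mathbb R^X$ is the set of all real-valued functions on $X$. $\mathcal F$ is pointwise bounded if $\sup_{f\in\mathcal F}|f(x)|<\infty$ for every $x\in X$. A function $g\in\mathbb R^X$ is summable along $\mathcal F$, written $g\in\mathcal S_{\mathcal F}(X)$, if the series $\sum_ng(x_n)a(x_n)$ converges for every sequence $(x_n)_{n\in\mathbb N}$ in $X$ and every $a\in\mathbb R^X$ such that $\sup_{f\in\mathcal F}\sum_n|f(x_n)a(x_n)|<+\infty$. $\mathbb P(\mathcal F;\mathcal E(X))$ is the set of finitely additive probabilities $m$ on the power set of $\mathcal F$ such that, for every $x\in X$, the evaluation $f\mapsto f(x)$ is $m$-integrable on $\mathcal F$ (Dunford–Schwartz integral). The $X$-topology is the topology of pointwise convergence on $\mathbb R^X$; ''$X$-closed'' means closed in $\mathbb R^X$ for it; $\mathscr B_X(\mathcal F)$ is the $\sigma$-algebra generated by the (relatively) $X$-open subsets of $\mathcal F$. *)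

(* Defs.v *)
From HB Require Import structures.
From mathcomp Require Import all_boot all_order all_algebra.
From mathcomp Require Import all_classical all_reals all_analysis.
Import Order.TTheory GRing.Theory Num.Theory.
Import numFieldNormedType.Exports.

Set Implicit Arguments.
Unset Strict Implicit.
Unset Printing Implicit Defensive.

Local Open Scope classical_set_scope.
Local Open Scope ring_scope.

(* Families of functions are sets F : set (X -> R). A set coerces to the type
   of its elements, so that T below will be the type F, and set functions
   m : set F -> R are defined on the whole power set of F. *)

Section FinitelyAdditive.
Context {R : realType} {T : Type}.
Implicit Types (m : set T -> R) (h : T -> R) (s : nat -> {fimfun T >-> R}).

Definition fa_probability m : Prop :=
  [/\ forall A, 0 <= m A,
      m [set: T] = 1
    & forall A B, A `&` B = set0 -> m (A `|` B) = m A + m B].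

(* Every function of finite range is simple for the power set, so
   {fimfun T >-> R} is the type of simple functions; the summands vanish off
   the range of f. *)
Definition simple_integral m (f : T -> R) : R :=
  \sum_(y \in [set: R]) y * m (f @^-1` [set y]).

(* On the power set, a nonnegative additive m is its own total variation and
   its own outer measure. *)
Definition cvg_in_fa_measure m (u : nat -> T -> R) h : Prop :=
  forall e : R, 0 < e -> m [set t | e < `|u n t - h t|] @[n --> \oo] --> (0 : R).

(* Determining sequences in the sense of Dunford and Schwartz. *)
Definition determining_seq m h s : Prop :=
  cvg_in_fa_measure m (fun n => s n : T -> R) h /\
  forall e : R, 0 < e ->
    \forall n & p \near \oo, simple_integral m (fun t => `|s n t - s p t|) < e.

Definition fa_integrable m h : Prop := exists s, determining_seq m h s.

(* The limit exists, and does not depend on the determining sequence, when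
   m is a finitely additive probability; the value is 0 when h is not integrable. *)
Definition fa_integral m h : R :=
  xget 0 [set I : R | exists2 s, determining_seq m h s
                    & simple_integral m (s n) @[n --> \oo] --> I].

End FinitelyAdditive.

Section Families.
Context {R : realType} {X : Type}.
Implicit Types (F : set (X -> R)) (g : X -> R).

Definition ptws_bounded F : Prop :=
  forall x, (ereal_sup [set `|f x|%:E | f in F] < +oo)%E.

Definition summable_along F g : Prop :=
  forall (u : nat -> X) (a : X -> R),
    (ereal_sup [set \sum_(0 <= n <oo) `|f (u n) * a (u n)|%:E | f in F] < +oo)%E ->
    cvgn (series (fun n => g (u n) * a (u n))).

(* The finitely additive probabilities on the power set of F that integrate
   every evaluation. *)
Definition eval_probability F (m : set F -> R) : Prop :=
  fa_probability m /\
  forall x, fa_integrable m (fun f : F => set_val f x).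

End Families.

(* The library's measurable types are pointed. [pointed_at t] is T pointed by t;
   the choice of t has no effect on the sigma-algebra. *)
Definition pointed_at {T : Type} (t : T) : Type := T.
HB.instance Definition _ (T : choiceType) (t : T) := Choice.on (pointed_at t).
HB.instance Definition _ (T : choiceType) (t : T) :=
  isPointed.Build (pointed_at t) t.

Definition borel_type {T : topologicalType} (t : T) :=
  g_sigma_algebraType (@open T : set (set (pointed_at t))).

(* Outer regular by open sets and inner regular by compact sets. On a compact
   Hausdorff space, inner regularity by closed sets is the same condition. *)
Definition regular {R : realType} {T : topologicalType} (mu : set T -> \bar R) :
    Prop :=
  forall A : set T, <<s @open T >> A ->
    mu A = ereal_inf [set mu U | U in [set U | open U /\ A `<=` U]] /\
    mu A = ereal_sup [set mu K | K in [set K | compact K /\ K `<=` A]].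

(* Main.v *)
Require Import Defs.
From HB Require Import structures.
From mathcomp Require Import all_boot all_order all_algebra.
From mathcomp Require Import all_classical all_reals all_analysis.
From mathcomp Require Import measurable_realfun zify lra.
Import Order.TTheory GRing.Theory Num.Theory.
Import numFieldNormedType.Exports.

Set Implicit Arguments.
Unset Strict Implicit.
Unset Printing Implicit Defensive.

Local Open Scope classical_set_scope.
Local Open Scope ring_scope.

(* If |g x| <= C \int |f x| m(df), then finite sums of |g (x_n) a (x_n)| are at
   most C times the supremum over F of the same sums for f, so the series of g
   converges absolutely. Conversely, a gliding hump turns summability into a
   constant C with \sum w |g| <= C sup_f \sum w |f| for all finite weights w >= 0.
   This inequality makes h |-> inf_w (sup_f (h f + C \sum w |f|) - \sum w |g|) a
   finite sublinear functional on the simple functions on F, and the values on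
   indicators of a linear functional below it form the desired m. If F is closed,
   it is compact by Tychonoff. The supremum of m over the closed subsets of an open
   set then extends to a regular Borel probability mu with m K <= mu K for K
   closed, and slicing |f x| by its level sets, which are closed, shows that
   \int |f x| dm <= \int |f x| dmu. *)

(** * Finitely additive integration *)

(** In the definition of summability the weight [a] depends on the point and not on its place in the
    sequence, so the humps must sit on disjoint finite sets. They can, because no single point
    obstructs the inequality: where all of [F] vanishes so does [g], and elsewhere one [f] with
    [f x != 0] gives a constant for [x]. Hence if no constant serves all weights, none serves the
    weights that avoid a given finite set. The sublinear functional packs two demands into one
    inequality: [m] is a mean, and [C |f x|] integrates to at least [|g x|]. The uniform constant
    keeps the functional from falling below the infimum of [h]. Pointwise boundedness makes each
    evaluation a uniform limit of simple functions, so values on simple functions determine the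
    integrals. The mass of a finitely additive [m] may accumulate at a closed set without lying on
    it, so [mu K] can exceed [m K]; the one-sided comparison is what domination requires. *)

Section FactorThroughFinType.
Context {T : Type} {V : choiceType}.

Lemma finite_range_comp (I : finType) (k : T -> I) (phi : I -> V) :
  finite_set (range (phi \o k)).
Proof.
apply: (@sub_finite_set _ _ (range phi)); first by move=> _ [t _ <-]; exists (k t).
exact: finite_image.
Qed.

Lemma finite_range_cst (v : V) : finite_set (range (fun _ : T => v)).
Proof. exact: (finite_range_comp (fun=> tt) (fun=> v)). Qed.

(** With the values of [f] as indices, integrals become finite sums over a [finType], and a product
    of index types lets two functions share one partition. *)
Lemma finite_range_factor (f : T -> V) : finite_set (range f) ->
  exists (I : finType) (k : T -> I) (phi : I -> V), f = phi \o k.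
Proof.
move=> /finite_seqP[A fA].
have fAt t : f t \in A.
  by have : [set` A] (f t) by rewrite -fA; exists t.
by exists (seq_sub A), (fun t => SeqSub (fAt t)), val; apply/funext => t.
Qed.

Lemma finite_range_factor2 (f g : T -> V) :
  finite_set (range f) -> finite_set (range g) ->
  exists (I : finType) (k : T -> I) (phi psi : I -> V),
    f = phi \o k /\ g = psi \o k.
Proof.
move=> /finite_range_factor[I [k [phi ->]]] /finite_range_factor[J [l [psi ->]]].
by exists (I * J)%type, (fun t => (k t, l t)), (phi \o fst), (psi \o snd).
Qed.

Lemma finite_range_op (op : V -> V -> V) (f g : T -> V) :
  finite_set (range f) -> finite_set (range g) ->
  finite_set (range (fun t => op (f t) (g t))).
Proof.
move=> ff fg; have [I [k [phi [psi [-> ->]]]]] := finite_range_factor2 ff fg.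
exact: (finite_range_comp k (fun i => op (phi i) (psi i))).
Qed.

End FactorThroughFinType.

Lemma indic_factor {R : nzRingType} {T : Type} (A : set T) :
  \1_A = (fun b : bool => b%:R) \o (fun t => t \in A) :> (T -> R).
Proof. by apply/funext => t; rewrite /= indicE. Qed.

Lemma finite_range_indic {R : nzRingType} {T : Type} (A : set T) :
  finite_set (range (\1_A : T -> R)).
Proof. by rewrite indic_factor; exact: finite_range_comp. Qed.

Section SimpleIntegral.
Context {R : realType} {T : Type} (m : set T -> R).
Hypothesis mP : fa_probability m.

Lemma fa_ge0 A : 0 <= m A. Proof. by case: mP. Qed.

Lemma fa_setT : m [set: T] = 1. Proof. by case: mP. Qed.

Lemma fa_setU A B : A `&` B = set0 -> m (A `|` B) = m A + m B.
Proof. by case: mP => _ _; exact. Qed.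

Lemma fa_set0 : m set0 = 0.
Proof.
have := fa_setU (setI0 set0); rewrite setU0 => h.
by apply: (addrI (m set0)); rewrite -h addr0.
Qed.

Lemma fa_le A B : A `<=` B -> m A <= m B.
Proof.
move=> AB; rewrite -(setDUK AB) fa_setU ?lerDl ?fa_ge0//.
by rewrite setDE setICA setICr setI0.
Qed.

Lemma fa_le_setU A B : m (A `|` B) <= m A + m B.
Proof.
rewrite (_ : A `|` B = A `|` (B `\` A)); last first.
  by rewrite setDE setUIr setUCr setIT.
rewrite fa_setU ?lerD2l ?fa_le//.
by rewrite setDE setICA setICr setI0.
Qed.

Lemma fa_preimage (I : finType) (k : T -> I) (P : pred I) :
  m [set t | P (k t)] = \sum_(i | P i) m (k @^-1` [set i]).
Proof.
have h (r : seq I) : uniq r ->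
    m [set t | k t \in r] = \sum_(i <- r) m (k @^-1` [set i]).
  elim: r => [_|i r ih /= /andP[ir ur]].
    by rewrite big_nil -fa_set0; congr m; apply/seteqP; split.
  rewrite big_cons -(ih ur) -fa_setU.
    congr m; apply/seteqP; split => t /=.
      by rewrite in_cons => /orP[/eqP|]; [left|right].
    by rewrite in_cons => -[->|->]; rewrite ?eqxx ?orbT.
  by apply/seteqP; split => // t /= [kt]; rewrite kt (negbTE ir).
transitivity (\sum_(i <- enum P) m (k @^-1` [set i])); last exact: big_enum.
rewrite -h ?enum_uniq//.
by congr m; apply/seteqP; split => t /=; rewrite mem_enum.
Qed.

(** [phi] may take one value at several indices; additivity merges the corresponding fibres of [k]
    into one level set. *)
Lemma simple_integral_comp (I : finType) (k : T -> I) (phi : I -> R) :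
  simple_integral m (phi \o k) = \sum_i phi i * m (k @^-1` [set i]).
Proof.
rewrite /simple_integral.
rewrite -(@fsbig_widen _ _ _ _ [set` undup (codom phi)])//; last first.
  move=> y /= [_]; rewrite mem_undup => /negP yphi.
  rewrite (_ : _ @^-1` _ = set0) ?fa_set0 ?mulr0//.
  by apply/seteqP; split => // t /= ty; rewrite -ty codom_f in yphi.
rewrite -fsbig_seq ?undup_uniq//.
transitivity (\sum_(y <- undup (codom phi)) \sum_(i | phi i == y)
    phi i * m (k @^-1` [set i])).
  apply: eq_bigr => y _.
  have -> : (phi \o k) @^-1` [set y] = [set t | phi (k t) == y].
    by apply/seteqP; split => t /= /eqP.
  rewrite (fa_preimage k (fun i => phi i == y)) mulr_sumr.
  by apply: eq_bigr => i /eqP ->.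
rewrite (exchange_big_dep xpredT)//=; apply: eq_bigr => i _.
rewrite big_const_seq (@eq_count _ _ (pred1 (phi i))); last first.
  by move=> y /=; rewrite eq_sym.
by rewrite count_uniq_mem ?undup_uniq// mem_undup codom_f/= addr0.
Qed.

Lemma simple_integralD f g : finite_set (range f) -> finite_set (range g) ->
  simple_integral m (fun t => f t + g t) =
  simple_integral m f + simple_integral m g.
Proof.
move=> ff fg; have [I [k [phi [psi [-> ->]]]]] := finite_range_factor2 ff fg.
rewrite !simple_integral_comp.
rewrite (simple_integral_comp k (fun i => phi i + psi i)) -big_split/=.
by apply: eq_bigr => i _; rewrite mulrDl.
Qed.

Lemma simple_integralZ c f : finite_set (range f) ->
  simple_integral m (fun t => c * f t) = c * simple_integral m f.
Proof.
move=> ff; have [I [k [phi ->]]] := finite_range_factor ff.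
rewrite !simple_integral_comp (simple_integral_comp k (fun i => c * phi i)).
by rewrite mulr_sumr; apply: eq_bigr => i _; rewrite mulrA.
Qed.

Lemma simple_integral_le f g : finite_set (range f) -> finite_set (range g) ->
  (forall t, f t <= g t) -> simple_integral m f <= simple_integral m g.
Proof.
move=> ff fg; have [I [k [phi [psi [-> ->]]]]] := finite_range_factor2 ff fg.
move=> fg_le; rewrite !simple_integral_comp; apply: ler_sum => i _.
have [[t kt]|nk] := pselect (exists t, k t = i).
  by apply: ler_wpM2r; rewrite ?fa_ge0// -kt; exact: fg_le.
(* Outside the image of [k] the coefficients need not be ordered, but there the fibre is empty. *)
rewrite (_ : k @^-1` _ = set0) ?fa_set0 ?mulr0//.
by apply/seteqP; split => // t kt; case: nk; exists t.
Qed.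

Lemma simple_integral_cst c : simple_integral m (fun=> c) = c.
Proof.
rewrite (simple_integral_comp (fun=> tt) (fun=> c)) (big_pred1 tt); last by case.
by rewrite (_ : _ @^-1` _ = setT) ?fa_setT ?mulr1//; exact/seteqP.
Qed.

Lemma simple_integral_indic A : simple_integral m \1_A = m A.
Proof.
rewrite indic_factor simple_integral_comp big_bool/= mul0r addr0 mul1r.
by congr m; apply/seteqP; split => t /=; [exact: set_mem | exact: mem_set].
Qed.

End SimpleIntegral.

Section DunfordSchwartz.
Context {R : realType} {T : Type} (m : set T -> R).
Hypothesis mP : fa_probability m.
Local Notation SI := (simple_integral m).

Lemma simple_integral_dist (f g : T -> R) :
  finite_set (range f) -> finite_set (range g) ->
  `|SI f - SI g| <= SI (fun t => `|f t - g t|).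
Proof.
move=> ff fg; have fd := finite_range_op (fun x y => `|x - y|) ff fg.
have fgD := simple_integralD mP fg fd; have ffD := simple_integralD mP ff fd.
have le1 : SI f <= SI g + SI (fun t => `|f t - g t|).
  rewrite -fgD; apply: simple_integral_le => //; first exact: (finite_range_op +%R).
  by move=> t; have := ler_norm (f t - g t); lra.
have le2 : SI g <= SI f + SI (fun t => `|f t - g t|).
  rewrite -ffD; apply: simple_integral_le => //; first exact: (finite_range_op +%R).
  by move=> t; have := ler_norm (g t - f t); rewrite distrC; lra.
by rewrite ler_norml; apply/andP; split; lra.
Qed.

Lemma simple_integral_dist_le (f g : T -> R) c :
  finite_set (range f) -> finite_set (range g) ->
  (forall t, `|f t - g t| <= c) -> `|SI f - SI g| <= c.
Proof.
move=> ff fg fgc; rewrite (le_trans (simple_integral_dist ff fg))//.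
rewrite -[leRHS](simple_integral_cst mP c); apply: simple_integral_le => //.
  exact: (finite_range_op (fun x y => `|x - y|)).
exact: finite_range_cst.
Qed.

Lemma finite_range_bounded (f : T -> R) :
  finite_set (range f) -> exists2 K, 0 <= K & forall t, `|f t| <= K.
Proof.
move=> /finite_range_factor[I [k [phi ->]]].
exists (\sum_i `|phi i|); first exact: sumr_ge0.
by move=> t; rewrite /= (bigD1 (k t))//= lerDl sumr_ge0.
Qed.

Lemma determining_cauchy h (s : nat -> {fimfun T >-> R}) :
  determining_seq m h s -> cvgn (fun n => SI (s n)).
Proof.
move=> [_ sC]; apply/cauchy_cvgP/cauchyP => e e0.
have [[A B] [[/= N1 _ HA] [/= N2 _ HB]] HAB] := sC _ e0.
pose N := maxn N1 N2.
exists (SI (s N)); exists N => // n /= Nn; rewrite /ball/=.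
have ffs k : finite_set (range (s k)) by exact: fimfunP.
apply: (le_lt_trans (simple_integral_dist (ffs N) (ffs n))).
apply: (HAB (N, n)); split => /=.
  by apply: HA; rewrite /= leq_maxl.
by apply: HB; rewrite /= (leq_trans _ Nn)// leq_maxr.
Qed.

(** This makes the integral independent of the determining sequence. Fix a large index [N] and a
    bound [K] of [|s N - u N|]. On the set [D] where [|s n - u n|] exceeds [e / 4], it is at most
    [|s n - s N| + |u n - u N| + K], and [m D] tends to 0. The two Cauchy terms, [K * m D] and the
    part off [D] take [e / 4] each. *)
Lemma determining_dist_cvg0 h (s u : nat -> {fimfun T >-> R}) :
  determining_seq m h s -> determining_seq m h u ->
  SI (fun t => `|s n t - u n t|) @[n --> \oo] --> (0 : R).
Proof.
move=> sh uh; apply/cvgrPdist_le => e e0.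
have e4 : 0 < e / 4 by lra.
have [[A B] [[/= N1 _ HA] [/= N2 _ HB]] HAB] := sh.2 _ e4.
have [[A' B'] [[/= N3 _ HA'] [/= N4 _ HB']] HAB'] := uh.2 _ e4.
pose N := maxn (maxn N1 N2) (maxn N3 N4).
have fs k : finite_set (range (s k)) by exact: fimfunP.
have fu k : finite_set (range (u k)) by exact: fimfunP.
have dist_fin (f g : T -> R) : finite_set (range f) -> finite_set (range g) ->
    finite_set (range (fun t => `|f t - g t|)).
  exact: (finite_range_op (fun x y => `|x - y|)).
have [K K0 HK] := finite_range_bounded (dist_fin _ _ (fs N) (fu N)).
(* [K] may be 0, hence [K + 1]; [m D] will be below twice this number. *)
have K1 : 0 < e / (8 * (K + 1)) by rewrite divr_gt0//; lra.
have e8 : 0 < e / 8 by lra.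
have /cvgrPdist_lt/(_ _ K1) ms := sh.1 _ e8.
have /cvgrPdist_lt/(_ _ K1) mu := uh.1 _ e8.
near=> n.
pose D := [set t | e / 4 < `|s n t - u n t|].
have mD : m D <= m [set t | e / 8 < `|s n t - h t|] +
                 m [set t | e / 8 < `|u n t - h t|].
  apply: (le_trans _ (fa_le_setU mP _ _)); apply: fa_le => // t /=.
  rewrite /D/= => Dt; have := ler_distD (h t) (s n t) (u n t).
  rewrite (distrC (h t)) => tri.
  by have [|] := ltP (e / 8) `|s n t - h t|; [left|right; lra].
have ms_n : m [set t | e / 8 < `|s n t - h t|] < e / (8 * (K + 1)).
  have : `|0 - m [set t | e / 8 < `|s n t - h t|]| < e / (8 * (K + 1)).
    by near: n.
  by rewrite sub0r normrN; apply: le_lt_trans; exact: ler_norm.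
have mu_n : m [set t | e / 8 < `|u n t - h t|] < e / (8 * (K + 1)).
  have : `|0 - m [set t | e / 8 < `|u n t - h t|]| < e / (8 * (K + 1)).
    by near: n.
  by rewrite sub0r normrN; apply: le_lt_trans; exact: ler_norm.
have KmD : K * m D <= e / 4.
  have : K * m D <= K * (e / (8 * (K + 1)) + e / (8 * (K + 1))).
    by apply: ler_wpM2l => //; lra.
  move=> /le_trans; apply.
  have : K * (e / (8 * (K + 1))) <= e / 8.
    by rewrite mulrA ler_pdivrMr; [nra | lra].
  by rewrite mulrDr; lra.
have Nn : (N <= n)%N by near: n; exists N.
have sC : SI (fun t => `|s n t - s N t|) < e / 4.
  apply: (HAB (n, N)); split => /=; [apply: HA|apply: HB] => /=.
    by rewrite (leq_trans _ Nn)// /N; lia.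
  by rewrite /N; lia.
have uC : SI (fun t => `|u n t - u N t|) < e / 4.
  apply: (HAB' (n, N)); split => /=; [apply: HA'|apply: HB'] => /=.
    by rewrite (leq_trans _ Nn)// /N; lia.
  by rewrite /N; lia.
have fs1 := dist_fin _ _ (fs n) (fs N).
have fu1 := dist_fin _ _ (fu n) (fu N).
have fc := @finite_range_cst T R.
have f1 : finite_set (range (\1_D : T -> R)) := finite_range_indic D.
have fK := finite_range_op (fun x _ => K * x) f1 f1.
have fKe := finite_range_op +%R fK (fc (e / 4)).
have fuKe := finite_range_op +%R fu1 fKe.
have fsuKe := finite_range_op +%R fs1 fuKe.
have : SI (fun t => `|s n t - u n t|) <= SI (fun t => `|s n t - s N t| +
    (`|u n t - u N t| + (K * \1_D t + e / 4))).
  apply: simple_integral_le => //; first exact: dist_fin.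
  move=> t; rewrite indicE; have [tD|/negP tD] := boolP (t \in D).
    have := ler_distD (s N t) (s n t) (u n t).
    have := ler_distD (u N t) (s N t) (u n t).
    by rewrite (distrC (u N t)) mulr1; have := HK t; rewrite normr_id => *; lra.
  have : `|s n t - u n t| <= e / 4.
    by rewrite leNgt; apply/negP => ?; apply: tD; rewrite inE.
  rewrite mulr0; have := normr_ge0 (s n t - s N t); have := normr_ge0 (u n t - u N t).
  by move=> *; lra.
rewrite simple_integralD// simple_integralD// simple_integralD//.
rewrite simple_integralZ// simple_integral_cst// simple_integral_indic// => le.
rewrite sub0r normrN ger0_norm; first by lra.
rewrite -[leLHS](simple_integral_cst mP 0); apply: simple_integral_le => //.
exact: dist_fin.
Unshelve. all: by end_near. Qed.

(** [xget] picks the limit along some determining sequence [v]; the preceding lemma carries it over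
    to [s]. *)
Lemma fa_integral_cvg h (s : nat -> {fimfun T >-> R}) :
  determining_seq m h s -> SI (s n) @[n --> \oo] --> fa_integral m h.
Proof.
move=> sh; have [I [u uh uI]] : exists I : R, exists2 u, determining_seq m h u
    & SI (u n) @[n --> \oo] --> I.
  by exists (limn (fun n => SI (s n))), s => //; exact: determining_cauchy sh.
rewrite /fa_integral; case: xgetP => [J _ [v vh vJ]|/(_ I)]; last first.
  by case; exists u.
have d0 := determining_dist_cvg0 sh vh.
apply/cvgrPdist_le => e e0; have e2 : 0 < e / 2 by lra.
move/cvgrPdist_le/(_ _ e2) : d0 => d0; move/cvgrPdist_le/(_ _ e2) : vJ => vJ.
near=> n.
have hd : SI (fun t => `|s n t - v n t|) <= e / 2.
  have : `|0 - SI (fun t => `|s n t - v n t|)| <= e / 2 by near: n.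
  by rewrite sub0r normrN; apply: le_trans; exact: ler_norm.
have hJ : `|J - SI (v n)| <= e / 2 by near: n.
have := simple_integral_dist (@fimfunP _ _ (s n)) (@fimfunP _ _ (v n)).
by have := ler_distD (SI (v n)) J (SI (s n)); rewrite (distrC (SI (v n))); lra.
Unshelve. all: by end_near. Qed.

Lemma uniform_determining h (s : nat -> {fimfun T >-> R}) :
  (forall n t, `|h t - s n t| <= n.+1%:R^-1) -> determining_seq m h s.
Proof.
move=> hs; split => [e e0|e e0].
  apply/cvgrPdist_le => r r0; near=> n.
  rewrite (_ : [set t | _] = set0) ?fa_set0 ?subrr ?normr0 ?ltW//.
  apply/seteqP; split => // t /=; apply/negP; rewrite -leNgt distrC.
  rewrite (le_trans (hs n t))// ltW//; near: n.
  exact: near_infty_natSinv_lt (PosNum e0).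
have e2 : 0 < e / 2 / 2 by lra.
have near_e : \forall n \near \oo, n.+1%:R^-1 < e / 2 / 2.
  exact: near_infty_natSinv_lt (PosNum e2).
near=> n p.
have [hn hp] : n.+1%:R^-1 < e / 2 / 2 /\ p.+1%:R^-1 < e / 2 / 2.
  by split; [near: n|near: p].
apply: (@le_lt_trans _ _ (e / 2)); last by lra.
rewrite -[leRHS](simple_integral_cst mP (e / 2)); apply: simple_integral_le => //.
- by apply: (finite_range_op (fun x y => `|x - y|)); exact: fimfunP.
- exact: finite_range_cst.
move=> t; have := ler_distD (h t) (s n t) (s p t); rewrite (distrC (s n t) (h t)).
move=> tri; rewrite /= (le_trans tri)//.
have := le_lt_trans (hs n t) hn; have := le_lt_trans (hs p t) hp; lra.
Unshelve. all: by end_near. Qed.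

(* h is rounded down to a multiple of e, after a shift by B that makes it
   nonnegative. *)
Lemma uniform_approx (h : T -> R) B e : (forall t, `|h t| <= B) -> 0 < e ->
  exists s : {fimfun T >-> R}, forall t, `|h t - s t| <= e.
Proof.
move=> hB e0; pose N := Num.truncn ((B + B) / e).
pose k t : 'I_N.+1 := inord (Num.truncn ((h t + B) / e)).
pose f := (fun i : 'I_N.+1 => i%:R * e - B) \o k.
have ff : finite_set (range f) by exact: finite_range_comp.
exists (fimfun_Sub (mem_set ff)) => t; rewrite fimfun_valP.
have := hB t; rewrite ler_norml => /andP[h1 h2].
have q0 : 0 <= (h t + B) / e by rewrite divr_ge0 ?(ltW e0)//; lra.
rewrite /f/= inordK; last first.
  by rewrite ltnS; apply: le_truncn; rewrite ler_pM2r ?invr_gt0//; lra.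
have /andP[] := truncn_itv q0.
rewrite -natr1 ler_pdivlMr// ltr_pdivrMr// => h3 h4.
by rewrite ger0_norm; lra.
Qed.

Lemma uniform_determining_exists h B : (forall t, `|h t| <= B) ->
  exists2 s : nat -> {fimfun T >-> R}, determining_seq m h s
    & forall n t, `|h t - s n t| <= n.+1%:R^-1.
Proof.
move=> hB.
have /choice[s hs] : forall n : nat, exists s : {fimfun T >-> R},
    forall t, `|h t - s t| <= n.+1%:R^-1.
  by move=> n; apply: (uniform_approx hB); rewrite invr_gt0.
by exists s => //; exact: uniform_determining.
Qed.

Lemma bounded_fa_integrable h B : (forall t, `|h t| <= B) -> fa_integrable m h.
Proof. by move=> /uniform_determining_exists[s sh _]; exists s. Qed.

(** One uniformly close simple function locates the integral up to the same error. Monotonicity,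
    additivity and homogeneity for bounded functions then come from simple functions, without a
    return to determining sequences. *)
Lemma fa_integral_approx h f e : finite_set (range f) ->
  (forall t, `|h t - f t| <= e) -> `|fa_integral m h - SI f| <= e.
Proof.
move=> ff hfe; have [K _ fK] := finite_range_bounded ff.
have hB t : `|h t| <= e + K.
  by have := ler_normD (h t - f t) (f t); rewrite subrK; have := hfe t;
    have := fK t; lra.
have [s sh hs] := uniform_determining_exists hB.
apply/ler_addgt0Pr => r r0; have r2 : 0 < r / 2 by lra.
have /cvgrPdist_le/(_ _ r2) sI := fa_integral_cvg sh.
near \oo => n.
have h1 : `|fa_integral m h - SI (s n)| <= r / 2 by near: n.
have h2 : n.+1%:R^-1 < r / 2.
  by near: n; exact: near_infty_natSinv_lt (PosNum r2).
have : `|SI (s n) - SI f| <= e + r / 2.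
  apply: simple_integral_dist_le => // t.
  have := ler_distD (h t) (s n t) (f t); rewrite (distrC (s n t) (h t)).
  by have := le_lt_trans (hs n t) h2; have := hfe t; lra.
by have := ler_distD (SI (s n)) (fa_integral m h) (SI f); lra.
Unshelve. all: by end_near. Qed.

Lemma fa_integral_le f h B B' : (forall t, `|f t| <= B) -> (forall t, `|h t| <= B') ->
  (forall t, f t <= h t) -> fa_integral m f <= fa_integral m h.
Proof.
move=> fB hB fh; apply/ler_addgt0Pr => e e0; have e4 : 0 < e / 4 by lra.
have [s sf] := uniform_approx fB e4; have [u uh] := uniform_approx hB e4.
have fs := @fimfunP _ _ s; have fu := @fimfunP _ _ u.
have fc : finite_set (range (fun _ : T => e / 2)).
  exact: finite_range_cst.
have : SI s <= SI (fun t => u t + e / 2).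
  apply: simple_integral_le => //; first exact: (finite_range_op +%R).
  move=> t; have := fh t; move: (sf t) (uh t); rewrite !ler_norml.
  by move=> /andP[? ?] /andP[? ?]; lra.
rewrite simple_integralD// simple_integral_cst//.
have := fa_integral_approx fs sf; have := fa_integral_approx fu uh.
by rewrite !ler_norml => /andP[? ?] /andP[? ?]; lra.
Qed.

Lemma fa_integralD f h B B' : (forall t, `|f t| <= B) -> (forall t, `|h t| <= B') ->
  fa_integral m (fun t => f t + h t) = fa_integral m f + fa_integral m h.
Proof.
move=> fB hB; apply/eqP; rewrite -subr_eq0 -normr_le0; apply/ler_addgt0Pr => e e0.
rewrite add0r; have e4 : 0 < e / 4 by lra.
have [s sf] := uniform_approx fB e4; have [u uh] := uniform_approx hB e4.
have fs := @fimfunP _ _ s; have fu := @fimfunP _ _ u.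
have : `|fa_integral m (fun t => f t + h t) - SI (fun t => s t + u t)| <= e / 2.
  apply: fa_integral_approx; first exact: (finite_range_op +%R).
  move=> t; move: (sf t) (uh t); rewrite !ler_norml.
  by move=> /andP[? ?] /andP[? ?]; lra.
rewrite simple_integralD//.
have := fa_integral_approx fs sf; have := fa_integral_approx fu uh.
by rewrite !ler_norml => /andP[? ?] /andP[? ?] /andP[? ?]; lra.
Qed.

Lemma fa_integralZ c f B : 0 <= c -> (forall t, `|f t| <= B) ->
  fa_integral m (fun t => c * f t) = c * fa_integral m f.
Proof.
move=> c0 fB; apply/eqP; rewrite -subr_eq0 -normr_le0; apply/ler_addgt0Pr => e e0.
rewrite add0r; have e4 : 0 < e / (2 * (c + 1)) by rewrite divr_gt0//; lra.
have ce : c * (e / (2 * (c + 1))) <= e / 2.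
  by rewrite mulrA ler_pdivrMr; [nra | lra].
have [s sf] := uniform_approx fB e4.
have fs := @fimfunP _ _ s.
have : `|fa_integral m (fun t => c * f t) - SI (fun t => c * s t)| <= e / 2.
  apply: fa_integral_approx; first exact: (finite_range_op (fun x _ => c * x) fs fs).
  by move=> t; rewrite -mulrBr normrM ger0_norm// (le_trans _ ce)// ler_wpM2l.
have : `|c * fa_integral m f - c * SI s| <= e / 2.
  rewrite -mulrBr normrM ger0_norm// (le_trans _ ce)// ler_wpM2l//.
  exact: fa_integral_approx.
rewrite simple_integralZ// !ler_norml => /andP[? ?] /andP[? ?]; lra.
Qed.

End DunfordSchwartz.

(** * Domination implies summability *)

Section Domination.
Context {R : realType} {X T : Type} (F : set (X -> R)).
Context (t0 : T) (ev : T -> X -> R) (evF : forall t, F (ev t)).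

Lemma partial_sum_le_ereal_sup (u : nat -> X) (a : X -> R) :
  (ereal_sup [set \sum_(0 <= n <oo) `|f (u n) * a (u n)|%:E | f in F] < +oo)%E ->
  exists M, forall t N, \sum_(0 <= n < N) `|ev t (u n)| * `|a (u n)| <= M.
Proof.
set S := ereal_sup _ => Soo.
have S_ge t : (\sum_(0 <= n <oo) `|ev t (u n) * a (u n)|%:E <= S)%E.
  by apply: ereal_sup_ubound; exists (ev t).
have Sfin : S \is a fin_num.
  rewrite ge0_fin_numE// (le_trans _ (S_ge t0))//.
  by apply: nneseries_ge0 => n _ _; rewrite lee_fin.
exists (fine S) => f N; rewrite -lee_fin fineK// (le_trans _ (S_ge f))//.
rewrite -sumEFin; under eq_bigr do rewrite -normrM.
by apply: nneseries_lim_ge => n _ _; rewrite lee_fin.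
Qed.

(* Both integrals of the theorem are instances of J, with D the class of
   functions that they integrate. *)
Lemma summable_of_domination (D : set (T -> R)) (J : (T -> R) -> R) (C : R)
    (g : X -> R) :
  (forall c, D (fun=> c) /\ J (fun=> c) = c) ->
  (forall p q, D p -> D q -> D (fun f => p f + q f) /\
     J (fun f => p f + q f) = J p + J q) ->
  (forall c p, 0 <= c -> D p -> D (fun f => c * p f) /\
     J (fun f => c * p f) = c * J p) ->
  (forall p q, D p -> D q -> (forall f, p f <= q f) -> J p <= J q) ->
  (forall x, D (fun f => `|ev f x|)) ->
  0 <= C -> (forall x, `|g x| <= C * J (fun f => `|ev f x|)) ->
  summable_along F g.
Proof.
move=> Jc JD JZ Jle Dev C0 gJ u a /partial_sum_le_ereal_sup[M HM].
have Jsum N : let p := fun f => \sum_(0 <= n < N) `|ev f (u n)| * `|a (u n)| in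
    D p /\ J p = \sum_(0 <= n < N) J (fun f => `|ev f (u n)|) * `|a (u n)|.
  elim: N => [|N [DN JN]] /=.
    by under eq_fun do rewrite big_nil; rewrite big_nil; exact: Jc.
  under eq_fun do rewrite big_nat_recr//= [_ * `|a _|]mulrC.
  have [DZ JZN] := JZ `|a (u N)| _ (normr_ge0 _) (Dev (u N)).
  have [DD JDN] := JD _ _ DN DZ.
  by rewrite big_nat_recr//= -JN [_ * `|a _|]mulrC -JZN -JDN.
apply: normed_cvg; apply: nondecreasing_is_cvgn.
  by apply: nondecreasing_series => n _ _; exact: normr_ge0.
exists (C * M) => _ [N _ <-]; rewrite /series/=.
have [DN JN] := Jsum N; have [DM JM] := Jc M.
have := Jle _ _ DN DM (HM^~ N); rewrite JN JM => /(ler_wpM2l C0).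
apply: le_trans; rewrite mulr_sumr; apply: ler_sum => n _.
by rewrite normrM mulrA ler_wpM2r.
Qed.

Lemma ptws_bounded_ev : ptws_bounded F ->
  forall x, exists B, forall t, `|ev t x| <= B.
Proof.
move=> Fb x; have := Fb x; set S := ereal_sup _ => Soo.
have S_ge t : (`|ev t x|%:E <= S)%E by apply: ereal_sup_ubound; exists (ev t).
have Sfin : S \is a fin_num.
  by rewrite ge0_fin_numE// (le_trans _ (S_ge t0))// lee_fin.
by exists (fine S) => t; rewrite -lee_fin fineK.
Qed.

Lemma fa_summable (m : set T -> R) (C : R) (g : X -> R) :
  ptws_bounded F -> fa_probability m -> 0 <= C ->
  (forall x, `|g x| <= C * fa_integral m (fun f => `|ev f x|)) ->
  summable_along F g.
Proof.
move=> Fb mP; apply: (summable_of_domination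
    (D := [set p | exists B, forall f, `|p f| <= B])).
- move=> c; split; first by exists `|c|.
  apply/eqP; rewrite -subr_eq0 -normr_le0.
  rewrite -[X in _ - X](simple_integral_cst mP c).
  apply: (fa_integral_approx mP) => [|t]; first exact: finite_range_cst.
  by rewrite subrr normr0.
- move=> p q [B pB] [B' qB']; split; last exact: fa_integralD pB qB'.
  by exists (B + B') => f; rewrite (le_trans (ler_normD _ _))// lerD.
- move=> c p c0 [B pB]; split; last exact: fa_integralZ pB.
  by exists (c * B) => f; rewrite normrM ger0_norm// ler_wpM2l.
- by move=> p q [B pB] [B' qB']; exact: fa_integral_le pB qB'.
- move=> x; have [B evB] := ptws_bounded_ev Fb x.
  by exists B => t; rewrite normr_id.
Qed.

End Domination.

Lemma measure_summable (R : realType) (X : Type) d (T : measurableType d)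
    (F : set (X -> R)) (t0 : T) (ev : T -> X -> R)
    (mu : probability T R) (C : R) (g : X -> R) :
  (forall t, F (ev t)) ->
  (forall x, mu.-integrable setT (fun t => (ev t x)%:E)) -> 0 <= C ->
  (forall x, `|g x| <= C * \int[mu]_t `|ev t x|) ->
  summable_along F g.
Proof.
move=> evF iev; apply: (@summable_of_domination R X T F t0 ev evF
    [set p : T -> R | mu.-integrable setT (EFin \o p)] (fun p => \int[mu]_t p t)).
- move=> c; split; first exact: finite_measure_integrable_cst.
  by rewrite Rintegral_cst// [X in fine X](probability_setT mu) mulr1.
- move=> p q ip iq; split; last exact: RintegralD.
  exact: (integrableD _ ip iq).
- move=> c p c0 ip; split; last exact: RintegralZl.
  exact: (integrableZl _ c ip).
- by move=> p q ip iq pq; exact: le_Rintegral.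
- by move=> x; exact: integrable_norm (iev x).
Qed.

(** * The uniform constant *)

Section UniformConstant.
Context {R : realType} {X : choiceType} (x0 : X) (F : set (X -> R)).
Implicit Types (s S : seq X) (c : X -> R).

(** If [F] vanishes at [x], the constant sequence [x] with weight 1 is an admissible test, and a
    series with constant term [g x] converges only if [g x = 0]. *)
Lemma summable_eq0 (g : X -> R) x : summable_along F g ->
  (forall f, F f -> f x = 0) -> g x = 0.
Proof.
move=> gF Fx.
have : cvgn (series (fun=> g x * 1)).
  apply: (gF (fun=> x) (fun=> 1)); apply: (@le_lt_trans _ _ 0%E) => //.
  apply: ge_ereal_sup => _ [f Ff <-].
  by rewrite eseries0// => n _ _; rewrite Fx// mul0r normr0.
by rewrite mulr1 => /cvg_series_cvg_0/(cvg_lim (@Rhausdorff R)); rewrite lim_cst.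
Qed.

(** [S] lists points that the weights must avoid, so that the gliding hump can move to fresh points.
    An arbitrary bound [M] replaces the supremum over [F], whose finiteness then needs no
    discussion. *)
Definition weight_bound (g : X -> R) S (C : R) := forall s c M,
  uniq s -> (forall x, x \in s -> x \notin S) -> (forall x, 0 <= c x) -> 0 <= M ->
  (forall f, F f -> \sum_(x <- s) `|f x| * c x <= M) ->
  \sum_(x <- s) `|g x| * c x <= C * M.

(** Readmitting one point costs a finite [C1]: the ratio [|g x| / |f x|] for some [f] with
    [f x != 0], or 0 if there is none, since then [g x = 0]. The term of [x] and the remaining sum
    obey the same bound [M] separately. *)
Lemma weight_bound_cons g x S C : summable_along F g -> 0 <= C ->
  weight_bound g (x :: S) C -> exists2 C', 0 <= C' & weight_bound g S C'.
Proof.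
move=> gF C0 gC.
have [C1 C10 HC1] : exists2 C1, 0 <= C1 & forall b M, 0 <= b -> 0 <= M ->
    (forall f, F f -> `|f x| * b <= M) -> `|g x| * b <= C1 * M.
  have [[f Ff fx]|nf] := pselect (exists2 f, F f & f x != 0); last first.
    exists 0 => // b M b0 M0 _; rewrite (summable_eq0 gF) ?normr0 ?mul0r//.
    by move=> f Ff; apply/eqP; apply/negPn/negP => fx; apply: nf; exists f.
  have fx0 : 0 < `|f x| by rewrite normr_gt0.
  exists (`|g x| / `|f x|); first by rewrite divr_ge0.
  move=> b M b0 M0 /(_ _ Ff) fb; rewrite -mulrA ler_wpM2l//.
  by rewrite ler_pdivlMl.
exists (C + C1); first exact: addr_ge0.
move=> s c M us sS c0 M0 fM.
have [xs|xs] := boolP (x \in s); last first.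
  apply: (@le_trans _ _ (C * M)); last by rewrite ler_wpM2r// lerDl.
  apply: gC => // y ys; rewrite in_cons negb_or sS// andbT.
  by apply: contraNneq xs => <-.
rewrite (big_rem x)//= mulrDl addrC lerD//.
  apply: gC => //; first exact: rem_uniq.
    move=> y; rewrite mem_rem_uniq// inE => /andP[yx ys].
    by rewrite in_cons negb_or sS// andbT.
  move=> f /fM; apply: le_trans; rewrite [leRHS](big_rem x)//= lerDr.
  by rewrite mulr_ge0.
apply: HC1 => // f /fM; apply: le_trans; rewrite [leRHS](big_rem x)//= lerDl.
by apply: sumr_ge0 => y _; rewrite mulr_ge0.
Qed.

(** No constant serves the weights off [S], so [2 ^+ k] fails for some weight. Division by its sum
    [G] against [|g|] normalises that sum to 1 and brings the sums of [F] down to [2^-1 ^+ k]. *)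
Lemma unbounded_weights g : summable_along F g ->
  ~ (exists2 C, 0 <= C & weight_bound g [::] C) ->
  forall (S : seq X) (k : nat), exists (sc : seq X * (X -> R)),
    [/\ uniq sc.1, forall x, x \in sc.1 -> x \notin S, forall x, 0 <= sc.2 x,
      forall f, F f -> \sum_(x <- sc.1) `|f x| * sc.2 x <= 2^-1 ^+ k
      & 1 <= \sum_(x <- sc.1) `|g x| * sc.2 x].
Proof.
move=> gF nb S k.
have {nb} : ~ (exists2 C, 0 <= C & weight_bound g S C).
  elim: S => [//|x S ih] [C C0 xS]; apply: ih; exact: weight_bound_cons xS.
move=> nS; apply: contrapT => nsc; apply: nS; exists (2 ^+ k) => //.
move=> s c M us sS c0 M0 fM; rewrite leNgt; apply/negP => gM.
set G := \sum_(x <- s) _ in gM.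
have G0 : 0 < G by apply: le_lt_trans gM; rewrite mulr_ge0.
apply: nsc; exists (s, fun x => c x / G); split => //=.
- by move=> x; rewrite divr_ge0// ltW.
- move=> f /fM {}fM; under eq_bigr do rewrite mulrA.
  rewrite -mulr_suml ler_pdivrMr// (le_trans fM)// exprVn mulrC.
  by rewrite ler_pdivlMr// mulrC ltW.
- by under eq_bigr do rewrite mulrA; rewrite -mulr_suml divff// gt_eqF.
Qed.

Lemma geometric_sum_le2 N : \sum_(0 <= j < N) 2^-1 ^+ j <= 2 :> R.
Proof.
suff -> : \sum_(0 <= j < N) 2^-1 ^+ j = 2 - 2 * 2^-1 ^+ N :> R.
  by rewrite gerBl mulr_ge0// exprn_ge0.
elim: N => [|N ih]; first by rewrite big_nil expr0; lra.
by rewrite big_nat_recr//= ih exprS; lra.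
Qed.

(* Gliding hump: the blocks s k are disjoint, the weights c k give F at most 2^-k
   and g at least 1 on s k, and u enumerates the blocks one after the other. *)
Lemma summable_weight_bound g : summable_along F g ->
  exists2 C, 0 <= C & weight_bound g [::] C.
Proof.
move=> gF; apply: contrapT => /(unbounded_weights gF) H.
have /choice[blk blkP] : forall Sk : seq X * nat, exists sc : seq X * (X -> R),
    [/\ uniq sc.1, forall x, x \in sc.1 -> x \notin Sk.1, forall x, 0 <= sc.2 x,
      forall f, F f -> \sum_(x <- sc.1) `|f x| * sc.2 x <= 2^-1 ^+ Sk.2
      & 1 <= \sum_(x <- sc.1) `|g x| * sc.2 x].
  by move=> [S k]; exact: H.
(* [S k] concatenates the blocks before the [k]-th one, which is chosen off [S k]. *)
pose S := fix S k := if k is k'.+1 then S k' ++ (blk (S k', k')).1 else [::].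
pose s k := (blk (S k, k)).1; pose c k := (blk (S k, k)).2.
have SS k : S k.+1 = S k ++ s k by [].
have s_sub j k x : (j < k)%N -> x \in s j -> x \in S k.
  elim: k => // k ih; rewrite ltnS leq_eqVlt SS mem_cat => /predU1P[->->|jk xj].
    by rewrite orbT.
  by rewrite ih.
have s_inj j k x : x \in s j -> x \in s k -> j = k.
  move=> xj xk; have [jk|kj|//] := ltngtP j k.
    by have [_ /(_ _ xk)/negP[]] := blkP (S k, k); exact: (s_sub j).
  by have [_ /(_ _ xj)/negP[]] := blkP (S j, j); exact: (s_sub k).
(* No block is empty, its sum against [|g|] being at least 1; so [S n.+1] has an entry at position
   [n] and [u n] never falls back on the default [x0]. *)
have size_S k : (k <= size (S k))%N.
  elim: k => // k ih; rewrite SS size_cat -addn1 leq_add// lt0n size_eq0.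
  apply/eqP => sk; have [_ _ _ _] := blkP (S k, k).
  by rewrite -/(s k) sk big_nil ler10.
have S_pre k l : (k <= l)%N -> exists t, S l = S k ++ t.
  elim: l => [|l ih]; first by rewrite leqn0 => /eqP ->; exists [::].
  rewrite leq_eqVlt => /predU1P[->|]; first by exists [::]; rewrite cats0.
  by rewrite ltnS => /ih[t Sl]; exists (t ++ s l); rewrite SS Sl catA.
pose u n := nth x0 (S n.+1) n.
have uE k n : (n < size (S k))%N -> u n = nth x0 (S k) n.
  move=> nk; rewrite /u; have [nk1|kn1] := leqP n.+1 k.
    by have [t ->] := S_pre _ _ nk1; rewrite nth_cat size_S.
  by have [t ->] := S_pre _ _ (ltnW kn1); rewrite nth_cat nk.
(* Disjointness of the blocks makes the value unique; points outside all blocks get 0. *)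
pose a x := xget 0 [set v | exists2 k, x \in s k & v = c k x].
have aE k x : x \in s k -> a x = c k x.
  move=> xk; rewrite /a; case: xgetP => [v _ [j xj ->]|/(_ (c k x))[]].
    by rewrite (s_inj _ _ _ xj xk).
  by exists k.
have a_ge0 x : 0 <= a x.
  rewrite /a; case: xgetP => [v _ [j _ ->]|//].
  by have [_ _ + _ _] := blkP (S j, j); exact.
have sumE (phi : X -> R) k : \sum_(0 <= n < size (S k)) phi (u n) * a (u n) =
    \sum_(0 <= j < k) \sum_(x <- s j) phi x * c j x.
  transitivity (\sum_(x <- S k) phi x * a x).
    rewrite [RHS](big_nth x0); apply: eq_big_nat => n /andP[_ nk].
    by rewrite (uE k).
  elim: k => [|k ih]; first by rewrite /S !big_nil.
  rewrite SS big_cat/= ih big_nat_recr//=; congr (_ + _).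
  by apply: eq_big_seq => x xk; rewrite (aE k).
(* The sign turns the tested series into that of [|g| a] and does not enlarge the series of [F]. *)
pose b x := Num.sg (g x) * a x.
have gb n : g (u n) * b (u n) = `|g (u n)| * a (u n).
  by rewrite /b mulrA [g _ * _]mulrC -normrEsg.
have : cvgn (series (fun n => g (u n) * b (u n))).
  apply: gF; apply: (@le_lt_trans _ _ 2%:E); last exact: ltry.
  apply: ge_ereal_sup => _ [f Ff <-].
  apply: lime_le; first by apply: is_cvg_nneseries => n _ _; rewrite lee_fin.
  apply: nearW => N; rewrite sumEFin lee_fin.
  apply: (@le_trans _ _ (\sum_(0 <= n < N) `|f (u n)| * a (u n))).
    apply: ler_sum => n _; rewrite /b !normrM normr_sg (ger0_norm (a_ge0 _)).
    by rewrite ler_wpM2l// ler_piMl// lern1 leq_b1.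
  apply: (@le_trans _ _ (\sum_(0 <= n < size (S N)) `|f (u n)| * a (u n))).
    rewrite [leRHS](big_cat_nat _ (size_S N))//= lerDl.
    by apply: sumr_ge0 => n _; rewrite mulr_ge0.
  rewrite (sumE (fun x => `|f x|)) (le_trans _ (geometric_sum_le2 N))//.
  apply: ler_sum => j _; have [_ _ _ + _] := blkP (S j, j); exact.
under eq_fun do rewrite gb.
move=> cg; set l := limn _ in cg.
have l_ge n : series (fun n => `|g (u n)| * a (u n)) n <= l.
  apply: nondecreasing_cvgn_le => //.
  by apply: nondecreasing_series => i _ _; rewrite mulr_ge0.
have l0 : 0 <= l by apply: le_trans (l_ge 0%N); rewrite /series/= big_nil.
(* [k] exceeds the limit [l], while each of the first [k] blocks contributes at least 1. *)
pose k := (Num.truncn l).+1.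
have : \sum_(0 <= n < size (S k)) `|g (u n)| * a (u n) <= l := l_ge _.
rewrite (sumE (fun x => `|g x|)).
apply/negP; rewrite -ltNge; have /andP[_ lk] := truncn_itv l0.
apply: (lt_le_trans lk).
rewrite [leLHS](_ : _ = \sum_(0 <= j < k) 1); last by rewrite sumr_const_nat subn0.
by apply: ler_sum => j _; have [_ _ _ _] := blkP (S j, j).
Qed.

End UniformConstant.

(** * Hahn-Banach *)

Section HahnBanach.
Context {R : realType} {V : lmodType R}.
Implicit Types (p q : V -> R) (u v : V).

Definition sublinear p :=
  (forall u v, p (u + v) <= p u + p v) /\
  (forall (c : R) v, 0 <= c -> p (c *: v) = c * p v).

Lemma sublinear0 p : sublinear p -> p 0 = 0.
Proof. by move=> [_ pZ]; rewrite -(scale0r (0 : V)) pZ// mul0r. Qed.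

Lemma sublinear_opp_ge p v : sublinear p -> - p (- v) <= p v.
Proof.
by move=> sp; have [pD _] := sp; have := pD v (- v); rewrite subrr sublinear0//; lra.
Qed.

Lemma sublinear_intro p : (forall u v, p (u + v) <= p u + p v) -> p 0 = 0 ->
  (forall (c : R) v, 0 < c -> p (c *: v) <= c * p v) -> sublinear p.
Proof.
move=> pD p0 pZ; split=> // c v; rewrite le_eqVlt => /predU1P[<-|c0].
  by rewrite scale0r mul0r.
apply/eqP; rewrite eq_le pZ//=; have ci : 0 < c^-1 by rewrite invr_gt0.
by have := pZ _ (c *: v) ci; rewrite scalerA mulVf ?gt_eqF// scale1r ler_pdivlMl.
Qed.

(** This bounds chains in Zorn's lemma. Subadditivity survives the infimum because the smaller of
    two members of the chain serves for both [u] and [v]; the infimum is finite because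
    [q v >= - q (- v) >= - p (- v)]. *)
Lemma sublinear_inf_chain p (A : set (V -> R)) : A !=set0 ->
  (forall q, A q -> sublinear q /\ forall v, q v <= p v) ->
  (forall q r, A q -> A r -> (forall v, q v <= r v) \/ (forall v, r v <= q v)) ->
  sublinear (fun v => inf [set q v | q in A]) /\
  forall q v, A q -> inf [set q v | q in A] <= q v.
Proof.
move=> [r Ar] Ap Atot; pose t v := inf [set q v | q in A].
suff : sublinear t /\ forall q v, A q -> t v <= q v by [].
have t_le q v : A q -> t v <= q v.
  move=> Aq; apply: ge_inf; last by exists q.
  exists (- p (- v)) => _ [q' /Ap[sq' q'p] <-].
  by rewrite (le_trans _ (sublinear_opp_ge v sq'))// lerN2.
have le_t v b : (forall q, A q -> b <= q v) -> b <= t v.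
  by move=> bq; apply: lb_le_inf => [|_ [q Aq <-]]; [exists (r v), r|exact: bq].
split=> //; apply: sublinear_intro.
- move=> u v; rewrite -lerBlDr; apply: (le_t) => q Aq.
  rewrite lerBlDr -lerBlDl; apply: (le_t) => q' Aq'; rewrite lerBlDl.
  have [qq'|q'q] := Atot _ _ Aq Aq'.
    have [[qD _] _] := Ap _ Aq; apply: (le_trans (t_le _ _ Aq)).
    by apply: (le_trans (qD u v)); rewrite lerD2l.
  have [[qD _] _] := Ap _ Aq'; apply: (le_trans (t_le _ _ Aq')).
  by apply: (le_trans (qD u v)); rewrite lerD2r.
- apply/eqP; rewrite eq_le le_t ?andbT => [|q /Ap[/sublinear0 ->]//].
  by have [/sublinear0 <- _] := Ap _ Ar; exact: t_le.
- move=> c v c0; rewrite -ler_pdivrMl//; apply: (le_t) => q Aq.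
  rewrite ler_pdivrMl// (le_trans (t_le _ _ Aq))//.
  by have [[_ ->]] := Ap _ Aq; rewrite // ltW.
Qed.

(* The pointwise minimal sublinear functionals are the linear ones: for fixed v,
   q is compared with the infimum over t >= 0 of q (u + t v) - t q v. *)
Lemma minimal_sublinear_superadditive q : sublinear q ->
  (forall r, sublinear r -> (forall v, r v <= q v) -> r = q) ->
  forall u v, q u + q v <= q (u + v).
Proof.
move=> sq qmin u0 v; have [qD qZ] := sq.
pose r u := inf [set q (u + t *: v) - t * q v | t in [set t | 0 <= t]].
have r_le u t : 0 <= t -> r u <= q (u + t *: v) - t * q v.
  move=> t0; apply: ge_inf; last by exists t.
  (* The lower bound comes from [t q v = q (t v) <= q (u + t v) + q (- u)]. *)
  exists (- q (- u)) => _ [t' /= t'0 <-]; have := qD (u + t' *: v) (- u).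
  by rewrite addrAC subrr add0r qZ//; lra.
have le_r u b : (forall t, 0 <= t -> b <= q (u + t *: v) - t * q v) -> b <= r u.
  move=> bq; apply: lb_le_inf => [|_ [t /= t0 <-]]; last exact: bq.
  by exists (q (u + 0 *: v) - 0 * q v), 0 => /=.
have rq u : r u <= q u.
  by have := r_le u 0 (lexx _); rewrite scale0r addr0 mul0r subr0.
have sr : sublinear r.
  apply: sublinear_intro => //.
  - move=> u w; rewrite -lerBlDr; apply: (le_r) => t t0.
    rewrite lerBlDr -lerBlDl; apply: (le_r) => t' t'0; rewrite lerBlDl.
    apply: (le_trans (r_le _ _ (addr_ge0 t0 t'0))).
    rewrite scalerDl addrACA; have := qD (u + t *: v) (w + t' *: v); lra.
  - apply/eqP; rewrite eq_le; have := rq 0; rewrite (sublinear0 sq) => -> /=.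
    by apply: (le_r) => t t0; rewrite add0r qZ// subrr.
  - move=> c u c0; rewrite -ler_pdivrMl//; apply: (le_r) => t t0.
    rewrite ler_pdivrMl//.
    apply: (le_trans (r_le _ (c * t) _)); first by rewrite mulr_ge0// ltW.
    by rewrite -scalerA -scalerDr qZ ?(ltW c0)// mulrBr mulrA.
(* Minimality gives [r = q], and the term [t = 1] of the infimum is the claim. *)
have := r_le u0 1 ler01; rewrite (qmin _ sr rq) scale1r mul1r; lra.
Qed.

(** Zorn's lemma runs over the sublinear functionals below [p], in reversed pointwise order. A
    minimal one is additive, hence odd, which settles negative scalars. *)
Theorem hahn_banach p : sublinear p -> exists f : V -> R,
  [/\ forall u v, f (u + v) = f u + f v, forall (c : R) v, f (c *: v) = c * f v
    & forall v, f v <= p v].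
Proof.
move=> sp; pose T := {q : V -> R | sublinear q /\ forall v, q v <= p v}.
pose le (q r : T) := `[< forall v, sval r v <= sval q v >].
have [] := @Zorn T le.
- by move=> q; apply/asboolP.
- move=> q r s /asboolP qr /asboolP rs; apply/asboolP => v.
  exact: le_trans (rs v) (qr v).
- move=> [q qp] [r rp] /asboolP/= qr /asboolP/= rq; apply: eq_exist.
  by apply/funext => v; apply/eqP; rewrite eq_le rq qr.
- move=> A Atot; have [[q0 Aq0]|A0] := pselect (A !=set0); last first.
    have pp : sublinear p /\ forall v, p v <= p v by [].
    by exists (exist _ p pp) => s As; case: A0; exists s.
  have [|_ [q Aq <-]|_ _ [q' Aq' <-] [r' Ar' <-]|st t_le] :=
      @sublinear_inf_chain p [set sval q | q in A].
  + by exists (sval q0), q0.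
  + by case: q {Aq}.
  + by have [/asboolP|/asboolP] := Atot _ _ Aq' Ar'; [right|left].
  set t := (X in sublinear X) in st t_le.
  have tp : sublinear t /\ forall v, t v <= p v.
    split=> // v; apply: (le_trans (t_le (sval q0) v _)); first by exists q0.
    by case: q0 {Aq0} => q [].
  exists (exist _ t tp) => s As; apply/asboolP => v /=.
  by apply: t_le; exists s.
move=> [q [sq qp]] qmax.
have qmin r : sublinear r -> (forall v, r v <= q v) -> r = q.
  move=> sr rq; have rp : sublinear r /\ forall v, r v <= p v.
    by split=> // v; exact: le_trans (rq v) (qp v).
  have := qmax (exist _ r rp); rewrite /le/= => H.
  by have /H[] : `[< forall v, r v <= q v >] by apply/asboolP.
have qD u v : q (u + v) = q u + q v.
  apply/eqP; rewrite eq_le; have [-> _] := sq.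
  exact: minimal_sublinear_superadditive.
have qN v : q (- v) = - q v.
  by have := qD v (- v); rewrite subrr sublinear0//; lra.
exists q; split=> // c v; have [c0|c0] := leP 0 c; first by have [_ ->] := sq.
have [_ qZ] := sq; rewrite -[c]opprK scaleNr qN qZ ?mulNr//.
by rewrite oppr_ge0 ltW.
Qed.

End HahnBanach.

(** * Simple functions as a vector space, and means on them *)

Section SimpleFunctions.
Context {R : realType} {T : Type}.
Implicit Types (f h : {fimfun T >-> R}) (c d : R).

Definition simple_of (f : T -> R) (ff : finite_set (range f)) : {fimfun T >-> R} :=
  fimfun_Sub (mem_set ff).

Lemma simple_ofE (f : T -> R) (ff : finite_set (range f)) t : simple_of ff t = f t.
Proof. by rewrite /simple_of fimfun_valP. Qed.

Definition simple_indic (A : set T) : {fimfun T >-> R} :=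
  simple_of (finite_range_indic A).

Lemma simple_indicE A t : simple_indic A t = (t \in A)%:R.
Proof. by rewrite simple_ofE indicE. Qed.

Definition fimfun_scale c f : {fimfun T >-> R} :=
  simple_of (finite_range_op (fun x _ => c * x) (@fimfunP _ _ f) (@fimfunP _ _ f)).

Lemma fimfun_scaleE c f t : fimfun_scale c f t = c * f t.
Proof. exact: simple_ofE. Qed.

Lemma fimfun_scaleA c d f : fimfun_scale c (fimfun_scale d f) = fimfun_scale (c * d) f.
Proof. by apply/fimfuneqP => t; rewrite !fimfun_scaleE mulrA. Qed.

Lemma fimfun_scale1 : left_id 1 fimfun_scale.
Proof. by move=> f; apply/fimfuneqP => t; rewrite fimfun_scaleE mul1r. Qed.

Lemma fimfun_scaleDr : right_distributive fimfun_scale +%R.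
Proof. by move=> c f h; apply/fimfuneqP => t; exact: mulrDr. Qed.

Lemma fimfun_scaleDl f : {morph fimfun_scale^~ f : c d / c + d}.
Proof. by move=> c d; apply/fimfuneqP => t; exact: mulrDl. Qed.

HB.instance Definition _ := GRing.Zmodule_isLmodule.Build R {fimfun T >-> R}
  fimfun_scaleA fimfun_scale1 fimfun_scaleDr fimfun_scaleDl.

Lemma fimfunZ c f t : (c *: f) t = c * f t.
Proof. exact: fimfun_scaleE. Qed.

End SimpleFunctions.

Section MeanOnSimpleFunctions.
Context {R : realType} {T : Type} (L : {fimfun T >-> R} -> R).
Hypothesis LD : forall f h, L (f + h) = L f + L h.
Hypothesis LZ : forall c f, L (c *: f) = c * L f.
Hypothesis L_le : forall (f : {fimfun T >-> R}) B, (forall t, f t <= B) -> L f <= B.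

Let m (A : set T) := L (simple_indic A).

Let LN f : L (- f) = - L f. Proof. by rewrite -scaleN1r LZ mulN1r. Qed.

Let L0 : L 0 = 0. Proof. by rewrite -(scale0r 0) LZ mul0r. Qed.

(** [L_le] at minus an indicator with bound 0 gives positivity; at the constants 1 and -1, with
    these values as bounds, it gives total mass 1. *)
Lemma mean_fa_probability : fa_probability m.
Proof.
split.
- move=> A; rewrite -oppr_le0 -LN; apply: L_le => t.
  by rewrite fimfunN /= oppr_le0 simple_indicE.
- apply/eqP; rewrite eq_le L_le => [/=|t]; last first.
    by rewrite simple_indicE; case: (_ \in _).
  rewrite -lerN2 -LN; apply: L_le => t.
  by rewrite fimfunN /= simple_indicE in_setT.
- move=> A B AB; rewrite /m -LD; congr L; apply/fimfuneqP => t.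
  rewrite fimfunD /= /simple_indic/= !indicE in_setU.
  have [tA|] := boolP (t \in A); have [tB|] := boolP (t \in B) => //=;
    rewrite ?addr0 ?add0r//.
  by have : (A `&` B) t; [split; exact/set_mem | rewrite AB].
Qed.

Lemma mean_simple_integral (f : {fimfun T >-> R}) : simple_integral m f = L f.
Proof.
have [I [k [phi fE]]] := finite_range_factor (@fimfunP _ _ f).
rewrite fE (simple_integral_comp mean_fa_probability).
have LS (r : seq I) : \sum_(i <- r) phi i * m (k @^-1` [set i]) =
    L (\sum_(i <- r) phi i *: simple_indic (k @^-1` [set i])).
  elim: r => [|i r ih]; first by rewrite !big_nil L0.
  by rewrite !big_cons LD LZ ih.
rewrite LS; congr L; apply/fimfuneqP => t.
rewrite fimfun_sum fE.
under eq_bigr do rewrite fimfunZ simple_indicE.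
rewrite (bigD1 (k t))//= mem_set// mulr1 big1 ?addr0// => i ikt.
by rewrite memNset ?mulr0// => kti; rewrite -kti eqxx in ikt.
Qed.

End MeanOnSimpleFunctions.

(** * From the uniform constant to a dominating probability *)

Section Domination.
Context {R : realType} {X : choiceType} (F : set (X -> R)) (f0 : F).
Implicit Types (W : seq (X * R)) (h : {fimfun F >-> R}).

(** Lists with repetitions allowed make concatenation the sum of two systems of weights. *)
Definition wsum (phi : X -> R) W := \sum_(p <- W) `|phi p.1| * p.2.

Definition nneg_weights W := forall p, p \in W -> 0 <= p.2.

Lemma wsum_ge0 phi W : nneg_weights W -> 0 <= wsum phi W.
Proof.
by move=> W0; rewrite /wsum big_seq sumr_ge0// => p /W0 p0; rewrite mulr_ge0.
Qed.

Lemma wsum_cat phi W W' : wsum phi (W ++ W') = wsum phi W + wsum phi W'.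
Proof. exact: big_cat. Qed.

Lemma wsum_scale phi c W :
  wsum phi [seq (p.1, c * p.2) | p <- W] = c * wsum phi W.
Proof.
by rewrite /wsum big_map mulr_sumr; apply: eq_bigr => p _ /=; rewrite mulrCA.
Qed.

(** Repeated points are merged, as [weight_bound] concerns lists without repetition. *)
Lemma wsum_undup phi W : wsum phi W = \sum_(x <- undup [seq p.1 | p <- W])
  `|phi x| * \sum_(p <- W | p.1 == x) p.2.
Proof.
transitivity (\sum_(x <- undup [seq p.1 | p <- W])
    \sum_(p <- W | p.1 == x) `|phi p.1| * p.2); last first.
  by apply: eq_bigr => x _; rewrite mulr_sumr; apply: eq_bigr => p /eqP ->.
rewrite (exchange_big_dep xpredT)//=; apply: eq_big_seq => p pW.
rewrite big_const_seq (@eq_count _ _ (pred1 p.1)); last first.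
  by move=> y /=; rewrite eq_sym.
by rewrite count_uniq_mem ?undup_uniq// mem_undup map_f/= ?addr0.
Qed.

Lemma weight_bound_wsum g C W M : weight_bound F g [::] C -> nneg_weights W ->
  0 <= M -> (forall f, F f -> wsum f W <= M) -> wsum g W <= C * M.
Proof.
move=> gC W0 M0 fM; rewrite wsum_undup; apply: gC => //.
- exact: undup_uniq.
- by move=> x; rewrite big_seq_cond sumr_ge0// => p /andP[/W0].
- by move=> f /fM; rewrite wsum_undup.
Qed.

Section Majorant.
Variables (g : X -> R) (C : R).
Hypotheses (C0 : 0 < C) (gC : weight_bound F g [::] C).

(** Upper bounds stand in for the supremum over [F], so one infimum over [B] covers both the
    supremum and the choice of weights. *)
Let bounds h : set R := [set B | exists2 W, nneg_weights W &
  forall f : F, h f + C * wsum (set_val f) W - wsum g W <= B].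

(* A linear functional below this one is at most sup h, and at most - |g x| at
   - C |f x|. *)
Definition majorant h := inf (bounds h).

(** Here the uniform constant enters. With [M = (B - K + wsum g W) / C] as bound for the sums of
    [F], it yields [wsum g W <= B - K + wsum g W]. This makes the majorant finite. *)
Let bounds_ge h K B : (forall f, K <= h f) -> bounds h B -> K <= B.
Proof.
move=> hK [W W0 hB].
have fW f : F f -> wsum f W <= (B - K + wsum g W) / C.
  move=> Ff; rewrite ler_pdivlMr// mulrC.
  have := hB (SigSub (mem_set Ff)); have := hK (SigSub (mem_set Ff)).
  rewrite /set_val/=; lra.
have M0 : 0 <= (B - K + wsum g W) / C.
  exact: le_trans (wsum_ge0 _ W0) (fW _ (set_valP f0)).
have := weight_bound_wsum gC W0 M0 fW.
by rewrite mulrC mulfVK ?gt_eqF//; lra.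
Qed.

Let bounds_lb h : has_lbound (bounds h).
Proof.
have [K _ hK] := finite_range_bounded (@fimfunP _ _ h).
exists (- K) => B; apply: bounds_ge => f.
by have := hK f; rewrite ler_norml => /andP[].
Qed.

Let bounds_nil h B : (forall f, h f <= B) -> bounds h B.
Proof.
move=> hB; exists [::] => [//|f].
by rewrite /wsum !big_nil mulr0 addr0 subr0.
Qed.

Let bounds_neq0 h : bounds h !=set0.
Proof.
have [K _ hK] := finite_range_bounded (@fimfunP _ _ h).
by exists K; apply: bounds_nil => f; rewrite (le_trans (ler_norm _)).
Qed.

Lemma majorant_le h B : bounds h B -> majorant h <= B.
Proof. by move=> hB; apply: ge_inf. Qed.

(** Weights enter linearly: concatenated lists give subadditivity, scaled lists homogeneity. *)
Lemma majorant_sublinear : sublinear majorant.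
Proof.
have le_maj h b : (forall B, bounds h B -> b <= B) -> b <= majorant h.
  by move=> hb; apply: lb_le_inf.
apply: sublinear_intro.
- move=> h k; rewrite -lerBlDr; apply: (le_maj) => B [W W0 hB].
  rewrite lerBlDr -lerBlDl; apply: (le_maj) => B' [W' W'0 kB']; rewrite lerBlDl.
  apply: majorant_le; exists (W ++ W').
    by move=> p; rewrite mem_cat => /orP[/W0|/W'0].
  move=> f; rewrite !wsum_cat fimfunD/=; have := hB f; have := kB' f; lra.
- apply/eqP; rewrite eq_le majorant_le/=; last exact: bounds_nil.
  by apply: le_maj => B; apply: bounds_ge.
- move=> c h c0; rewrite -ler_pdivrMl//; apply: (le_maj) => B [W W0 hB].
  rewrite ler_pdivrMl//; apply: majorant_le.
  exists [seq (p.1, c * p.2) | p <- W].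
    by move=> _ /mapP[p /W0 p0 ->] /=; rewrite mulr_ge0// ltW.
  move=> f; rewrite !wsum_scale fimfunZ; have /(ler_wpM2l (ltW c0)) := hB f; lra.
Qed.

Lemma weight_bound_fa_probability :
  (forall x, exists B, forall f, F f -> `|f x| <= B) ->
  exists2 m : set F -> R, fa_probability m &
    forall x, `|g x| <= C * fa_integral m (fun f => `|set_val f x|).
Proof.
move=> Fb; have [L [LD LZ L_maj]] := hahn_banach majorant_sublinear.
have L_le h B : (forall f, h f <= B) -> L h <= B.
  move=> hB; apply: (le_trans (L_maj h)); apply: majorant_le; exact: bounds_nil.
have mP := mean_fa_probability LD LZ L_le.
exists (fun A => L (simple_indic A)) => // x.
have [B evB] := Fb x.
(* [|f x|] need not be simple and is replaced by a simple [s] within [d]. The error [d] occurs twice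
   and is multiplied by [C], which makes [e]. *)
apply/ler_addgt0Pr => e e0; have [d d0 Cd] : exists2 d, 0 < d & C * d = e / 2.
  exists (e / 2 / C); first by rewrite !divr_gt0.
  by rewrite mulrCA divff ?gt_eqF// mulr1.
have evB' (f : F) : `| `|set_val f x| | <= B by rewrite normr_id evB//; exact: set_valP.
have [s sE] := uniform_approx evB' d0.
have := fa_integral_approx mP (@fimfunP _ _ s) sE.
rewrite (mean_simple_integral LD LZ L_le) ler_norml => /andP[Ls _].
(* As [s + d >= |f x|], the single weight 1 at [x] puts [- |g x|] among the [bounds] of [k]. *)
pose k := (- C) *: (s + simple_of (finite_range_cst (d))).
have Lk : L k <= - `|g x|.
  apply: (le_trans (L_maj k)); apply: majorant_le.
  exists [:: (x, 1)]; first by move=> p; rewrite inE => /eqP ->.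
  move=> f; rewrite /wsum !big_seq1 !mulr1 fimfunZ fimfunD /=.
  suff : C * `|set_val f x| <= C * (s f + d) by lra.
  rewrite (ler_wpM2l (ltW C0))//.
  by have := sE f; rewrite ler_norml => /andP[_]; lra.
have L1 : L (simple_of (finite_range_cst (d))) <= d.
  by apply: L_le => f; rewrite simple_ofE.
move: Lk; rewrite /k LZ LD mulNr lerN2 => Lk.
have : C * (L s + L (simple_of (finite_range_cst (d)))) <=
    C * ((fa_integral (fun A => L (simple_indic A)) (fun f => `|set_val f x|) +
       d) + d).
  by rewrite (ler_wpM2l (ltW C0))//; lra.
by rewrite !mulrDr Cd; lra.
Qed.

End Majorant.

Lemma summable_fa_probability g : (forall x, exists B, forall f, F f -> `|f x| <= B) ->
  X -> summable_along F g ->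
  exists (C : R) (m : set F -> R), [/\ 0 <= C, fa_probability m &
    forall x, `|g x| <= C * fa_integral m (fun f => `|set_val f x|)].
Proof.
move=> Fb x0 /(summable_weight_bound x0)[C C0 gC].
(* The construction divides by the constant, and [C] may be 0. *)
have gC1 : weight_bound F g [::] (C + 1).
  move=> s c M us sS c0 M0 fM; apply: (le_trans (gC s c M us sS c0 M0 fM)).
  by rewrite ler_wpM2r// lerDl.
have C1 : 0 < C + 1 by lra.
have [m mP gm] := weight_bound_fa_probability C1 gC1 Fb.
by exists (C + 1), m; split => //; exact: ltW.
Qed.

End Domination.

(** * Regular Borel extension *)

Section OuterContent.
Context {R : realType} {T : topologicalType} (m : set T -> R).
Hypothesis mP : fa_probability m.

(** As in the Riesz representation theorem, open sets are measured from inside and then all sets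
    from outside. Only the values of [m] on closed sets enter. *)
Definition open_content (U : set T) : R :=
  sup [set m K | K in [set K | closed K /\ K `<=` U]].

Definition outer_content (A : set T) : R :=
  inf [set open_content U | U in [set U | open U /\ A `<=` U]].

Lemma open_content_ge K U : closed K -> K `<=` U -> m K <= open_content U.
Proof.
move=> clK KU; apply: ub_le_sup; last by exists K.
by exists (m setT) => _ [K' _ <-]; apply: fa_le.
Qed.

Lemma open_content_le U b :
  (forall K, closed K -> K `<=` U -> m K <= b) -> open_content U <= b.
Proof.
move=> Ub; apply: ge_sup => [|_ [K [clK KU] <-]]; last exact: Ub.
by exists (m set0), set0 => //; split => //; exact: closed0.
Qed.

Lemma open_content_ge0 U : 0 <= open_content U.
Proof. by rewrite -(fa_set0 mP); apply: open_content_ge => //; exact: closed0. Qed.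

Lemma le_open_content U V : U `<=` V -> open_content U <= open_content V.
Proof.
move=> UV; apply: open_content_le => K clK KU; apply: open_content_ge => //.
exact: subset_trans UV.
Qed.

Lemma open_content_setT : open_content setT = 1.
Proof.
apply/eqP; rewrite -(fa_setT mP) eq_le; apply/andP; split.
  by apply: open_content_le => K _ _; exact: fa_le.
by apply: open_content_ge => //; exact: closedT.
Qed.

Lemma open_content_approx U e : 0 < e ->
  exists K, [/\ closed K, K `<=` U & open_content U - e < m K].
Proof.
move=> e0; apply: contrapT => nK.
suff : open_content U <= open_content U - e by lra.
apply: open_content_le => K clK KU; rewrite leNgt; apply/negP => lt.
by apply: nK; exists K.
Qed.

Lemma outer_content_le A U : open U -> A `<=` U -> outer_content A <= open_content U.
Proof.
move=> oU AU; apply: ge_inf; last by exists U.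
by exists 0 => _ [V _ <-]; exact: open_content_ge0.
Qed.

Lemma outer_content_ge A b :
  (forall U, open U -> A `<=` U -> b <= open_content U) -> b <= outer_content A.
Proof.
move=> Ab; apply: lb_le_inf => [|_ [U [oU AU] <-]]; last exact: Ab.
by exists (open_content setT), setT => //; split => //; exact: openT.
Qed.

Lemma outer_content_ge0 A : 0 <= outer_content A.
Proof. by apply: outer_content_ge => U _ _; exact: open_content_ge0. Qed.

Lemma le_outer_content A B : A `<=` B -> outer_content A <= outer_content B.
Proof.
move=> AB; apply: outer_content_ge => U oU BU; apply: outer_content_le => //.
exact: subset_trans BU.
Qed.

Lemma outer_content_open U : open U -> outer_content U = open_content U.
Proof.
move=> oU; apply/eqP; rewrite eq_le outer_content_le//=.
by apply: outer_content_ge => V _; exact: le_open_content.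
Qed.

Lemma outer_content_set0 : outer_content set0 = 0.
Proof.
rewrite (outer_content_open open0); apply/eqP; rewrite eq_le open_content_ge0 andbT.
by apply: open_content_le => K _; rewrite subset0 => ->; rewrite fa_set0.
Qed.

Lemma outer_content_approx A e : 0 < e ->
  exists U, [/\ open U, A `<=` U & open_content U < outer_content A + e].
Proof.
move=> e0; apply: contrapT => nU.
suff : outer_content A + e <= outer_content A by lra.
apply: outer_content_ge => U oU AU; rewrite leNgt; apply/negP => lt.
by apply: nU; exists U.
Qed.

Lemma le_closed_outer_content K : closed K -> m K <= outer_content K.
Proof.
by move=> clK; apply: outer_content_ge => U _ KU; exact: open_content_ge.
Qed.

Lemma open_content_disjoint_closed U K L : closed K -> closed L -> K `<=` U ->
  L `<=` U -> K `&` L = set0 -> m K + m L <= open_content U.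
Proof.
move=> clK clL KU LU KL; rewrite -(fa_setU mP)//; apply: open_content_ge.
  exact: closedU.
by move=> t [/KU|/LU].
Qed.

(* K is an almost optimal closed subset of U `&` V, and L one of U `\` K. *)
Lemma outer_content_split U V : open U -> open V ->
  outer_content (U `&` V) + outer_content (U `&` ~` V) <= open_content U.
Proof.
move=> oU oV; apply/ler_addgt0Pr => e e0; have e2 : 0 < e / 2 by lra.
have [K [clK KUV mK]] := open_content_approx (U `&` V) e2.
have [L [clL LUK mL]] := open_content_approx (U `\` K) e2.
have oUK : open (U `\` K) by apply: openI => //; exact: closed_openC.
have : outer_content (U `&` ~` V) <= open_content (U `\` K).
  by apply: outer_content_le => // t [Ut Vt]; split=> // /KUV[].
have : outer_content (U `&` V) <= open_content (U `&` V).
  by apply: outer_content_le => //; exact: openI.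
have : m K + m L <= open_content U.
  apply: open_content_disjoint_closed => //.
  - by move=> t /KUV[].
  - by move=> t /LUK[].
  - by apply/seteqP; split => // t [Kt /LUK[]].
lra.
Qed.

Hypothesis hT : hausdorff_space T.
Hypothesis cT : compact [set: T].

(** Compact Hausdorff spaces are normal: the part of [K] outside [U] lies in an open [G] inside some
    [B] with [closure B] inside [V]. Removing [G] from [K] leaves a part in [U], and [closure B]
    cuts out a part in [V]. *)
Lemma closed_split (K U V : set T) : closed K -> open U -> open V -> K `<=` U `|` V ->
  exists K1 K2, [/\ closed K1, closed K2, K1 `<=` U, K2 `<=` V & K = K1 `|` K2].
Proof.
move=> clK oU oV KUV.
have clKU : closed (K `\` U) by apply: closedI => //; exact: open_closedC.
have KUV' : K `\` U `<=` V by move=> t [/KUV[]].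
have nV : set_nbhs (K `\` U) V by move=> t /KUV' Vt; apply: open_nbhs_nbhs.
have [B /set_nbhsP[G [oG KUG GB]] BV] := compact_normal hT cT clKU nV.
exists (K `&` ~` G), (K `&` closure B); split.
- by apply: closedI => //; exact: open_closedC.
- by apply: closedI => //; exact: closed_closure.
- move=> t [Kt nGt]; apply: contrapT => Ut; apply: nGt; exact: KUG.
- by move=> t [_ /BV].
- apply/seteqP; split => [t Kt|t [[]|[]]]//.
  have [Gt|] := pselect (G t); last by left.
  by right; split=> //; apply: subset_closure; exact: GB.
Qed.

Lemma closed_cover_le (K : set T) (U : nat -> set T) N :
  closed K -> (forall n, open (U n)) ->
  K `<=` \bigcup_(n in `I_N) U n -> m K <= \sum_(0 <= n < N) open_content (U n).
Proof.
move=> + oU; elim: N K => [|N ih] K clK KU.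
  rewrite big_nil (_ : K = set0) ?fa_set0//.
  by apply/seteqP; split => // t /KU[].
have [|t /KU[n /=]|K1 [K2 [cl1 cl2 K1U K2U ->]]] :=
  @closed_split K (\bigcup_(n in `I_N) U n) (U N) clK _ (oU N).
- exact: bigcup_open.
- rewrite ltnS leq_eqVlt => /predU1P[->|nN] Un; first by right.
  by left; exists n.
rewrite big_nat_recr//= (le_trans (fa_le_setU mP _ _))// lerD//; first exact: ih.
exact: open_content_ge.
Qed.

Lemma closed_bigcup_cover (K : set T) (U : nat -> set T) :
  closed K -> (forall n, open (U n)) ->
  K `<=` \bigcup_n U n -> exists N, K `<=` \bigcup_(n in `I_N) U n.
Proof.
move=> clK oU KU; have cK : compact K by apply: (subclosed_compact clK cT).
move/compact_near_coveringP : cK => /(_ nat \oo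
   (fun N t => (\bigcup_(n in `I_N) U n) t)).
case=> [t Kt|N _ HN]; last by exists N; exact: (HN N (leqnn N)).
have [n _ Unt] := KU t Kt.
exists (U n, [set N | (n < N)%N]); last by move=> [t' N] [/= Ut' nN]; exists n.
split; first by apply: open_nbhs_nbhs; split => //; exact: oU.
by exists n.+1.
Qed.

Local Open Scope ereal_scope.

(** A closed subset of the union of near-optimal open sets [U n] is covered by finitely many of
    them, where finite subadditivity applies. The errors [e / 2 * 2^-1 ^+ n] add up to at most
    [e]. *)
Lemma outer_content_sigma_subadditive :
  sigma_subadditive (fun A => (outer_content A)%:E).
Proof.
move=> A; apply/lee_addgt0Pr => e e0.
have /choice[U UP] : forall n, exists U, [/\ open U, A n `<=` U &
    (open_content U < outer_content (A n) + e / 2 * 2^-1 ^+ n)%R].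
  by move=> n; apply: outer_content_approx; rewrite mulr_gt0 ?exprn_gt0// divr_gt0.
have oU n : open (U n) by have [] := UP n.
apply: (@le_trans _ _ (open_content (\bigcup_n U n))%:E).
  rewrite lee_fin; apply: outer_content_le; first exact: bigcup_open.
  by move=> t [n _ At]; exists n => //; have [_ + _] := UP n; exact.
have [S0|nS] := pselect (\sum_(i <oo) (outer_content (A i))%:E = +oo).
  by rewrite S0 leey.
have Sfin : \sum_(i <oo) (outer_content (A i))%:E \is a fin_num.
  rewrite ge0_fin_numE ?ltey; first exact/eqP.
  by apply: nneseries_ge0 => n _ _; rewrite lee_fin outer_content_ge0.
rewrite -(fineK Sfin) -EFinD lee_fin; apply: open_content_le => K clK KU.
have [N KN] := closed_bigcup_cover clK oU KU.
apply: (le_trans (closed_cover_le clK oU KN)).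
apply: (@le_trans _ _ (\sum_(0 <= n < N) (outer_content (A n) + e / 2 * 2^-1 ^+ n))%R).
  by apply: ler_sum => n _; apply/ltW; have [] := UP n.
rewrite big_split/= lerD//.
  rewrite -lee_fin fineK// -sumEFin; apply: nneseries_lim_ge => n _ _.
  by rewrite lee_fin outer_content_ge0.
rewrite -mulr_sumr -[leRHS](@divfK _ 2%R)// ler_pM2l ?divr_gt0//.
exact: geometric_sum_le2.
Qed.

End OuterContent.

Section RegularBorelProbability.
Context {R : realType} {T : topologicalType} (t0 : T) (m : set T -> R).
Hypothesis mP : fa_probability m.
Hypothesis hT : hausdorff_space T.
Hypothesis cT : compact [set: T].
Local Open Scope ereal_scope.

Let outer (A : set (pointed_at t0)) : \bar R := (@outer_content R T m A)%:E.

Let outer0 : outer set0 = 0.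
Proof. by rewrite /outer outer_content_set0. Qed.

Let outer_ge0 A : 0 <= outer A.
Proof. by rewrite lee_fin outer_content_ge0. Qed.

Let outer_le : {homo outer : A B / A `<=` B >-> A <= B}.
Proof. by move=> A B AB; rewrite lee_fin le_outer_content. Qed.

HB.instance Definition _ := isOuterMeasure.Build R (pointed_at t0) outer
  outer0 outer_ge0 outer_le (outer_content_sigma_subadditive mP hT cT).

(** An arbitrary [A] is enclosed in an open [V], which [outer_content_split] cuts along [U]. *)
Let caratheodory_open (U : set (pointed_at t0)) : @open T U -> outer.-caratheodory U.
Proof.
move=> oU; apply: le_caratheodory_measurable => A.
rewrite -EFinD lee_fin; apply: (@outer_content_ge R T m A) => V oV AV.
apply: le_trans (outer_content_split mP oV oU).
by rewrite lerD// (le_outer_content mP)//; apply: setSI.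
Qed.

Let caratheodory_borel (A : set (borel_type t0)) :
  measurable A -> outer.-caratheodory A.
Proof.
move: A; apply: smallest_sub; last exact: caratheodory_open.
exact: (@sigma_algebra_measurable _ (caratheodory_type outer)).
Qed.

(** The function [outer] again, retyped so that its measurable sets are the Borel sets. *)
Definition regular_extension (A : set (borel_type t0)) : \bar R :=
  (@outer_content R T m A)%:E.

Let regular_extension0 : regular_extension set0 = 0.
Proof. exact: outer0. Qed.

Let regular_extension_ge0 A : 0 <= regular_extension A.
Proof. exact: outer_ge0. Qed.

Let regular_extension_semi_sigma_additive : semi_sigma_additive regular_extension.
Proof.
move=> A mA tA mbigcupA.
apply: (@caratheodory_measure_sigma_additive R (pointed_at t0) outer A) => //.
- by move=> n; exact: caratheodory_borel.
- exact: caratheodory_borel.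
Qed.

HB.instance Definition _ := isMeasure.Build _ _ R regular_extension
  regular_extension0 regular_extension_ge0 regular_extension_semi_sigma_additive.

Let regular_extension_setT : regular_extension setT = 1.
Proof.
rewrite /regular_extension outer_content_open ?open_content_setT//.
exact: openT.
Qed.

HB.instance Definition _ := Measure_isProbability.Build _ _ R regular_extension
  regular_extension_setT.

(** Outer regularity holds by construction. Applied to the complement of [A], it gives inner
    regularity: an open set around that complement has a compact complement inside [A]. *)
Lemma regular_extension_regular : @regular R T regular_extension.
Proof.
move=> A mA; have mu_le (B C : set T) : B `<=` C ->
    regular_extension B <= regular_extension C.
  by move=> BC; rewrite lee_fin le_outer_content.
have mu_approx (B : set T) e : (0 < e)%R -> exists U : set T, [/\ open U, B `<=` U &
    regular_extension U <= regular_extension B + e%:E].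
  move=> e0; have [U [oU BU Ue]] := @outer_content_approx R T m B e e0.
  by exists U; split; rewrite // -EFinD lee_fin outer_content_open// ltW.
split; apply/eqP; rewrite eq_le; apply/andP; split.
- by apply: le_ereal_inf_tmp => _ [U [oU AU] <-]; exact: mu_le.
- apply/lee_addgt0Pr => e e0; have [U [oU AU Ue]] := mu_approx A e e0.
  by apply: le_trans Ue; apply: ereal_inf_lbound; exists U.
- apply/lee_addgt0Pr => e e0; have [U [oU AU Ue]] := mu_approx (~` A) e e0.
  have mU : measurable (U : set (borel_type t0)) by exact: sub_sigma_algebra.
  apply: (@le_trans _ _ (regular_extension (~` U) + e%:E)).
    have muA := probability_setC regular_extension mA.
    have muU := probability_setC regular_extension mU.
    move: Ue; rewrite muA muU.
    rewrite -!EFinB -!EFinD !lee_fin /=; lra.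
  rewrite leeD2r//; apply: ereal_sup_ubound; exists (~` U) => //; split.
    by apply: subclosed_compact cT _ => //; exact: open_closedC.
  by rewrite -[A]setCK; exact: subsetC.
- by apply: ge_ereal_sup => _ [K [_ KA] <-]; exact: mu_le.
Qed.

Definition regular_extension_probability : probability (borel_type t0) R :=
  regular_extension.

End RegularBorelProbability.

(** * Comparison of the finitely additive and the Lebesgue integral *)

Lemma sum_lt_nat {R : numDomainType} (n N : nat) : (n <= N)%N ->
  \sum_(0 <= k < N) (k < n)%N%:R = n%:R :> R.
Proof.
move=> nN; rewrite (big_cat_nat (leq0n n) nN)/=.
rewrite [X in _ + X]big_nat_cond [X in _ + X]big1 ?addr0; last first.
  by move=> k /andP[/andP[nk _] _]; rewrite ltnNge nk.
rewrite (eq_big_nat _ _ (F2 := fun=> 1)) ?sumr_const_nat ?subn0//.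
by move=> k /andP[_ ->].
Qed.

Lemma bounded_probability_integrable (R : realType) d (T : measurableType d)
    (P : probability T R) (f : T -> R) C :
  measurable_fun setT f -> (forall t, `|f t| <= C) ->
  P.-integrable setT (EFin \o f).
Proof.
move=> mf fC; apply: measurable_bounded_integrable => //.
  by rewrite [X in (X < _)%E](probability_setT P) ltry.
exists C; split; first exact: num_real.
by move=> x Cx t _ /=; rewrite (le_trans (fC t))// ltW.
Qed.

(* Layer cake: h is within e of the sum of e times the indicators of its level
   sets h >= (k + 1) e. *)
Lemma fa_integral_le_Rintegral (R : realType) d (T : measurableType d)
    (P : probability T R) (m : set T -> R) (h : T -> R) B :
  fa_probability m -> measurable_fun setT h ->
  (forall t, 0 <= h t) -> (forall t, h t <= B) ->
  (forall r, m [set t | r <= h t] <= fine (P [set t | r <= h t])) ->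
  fa_integral m h <= \int[P]_t h t.
Proof.
move=> mP mh h0 hB mPh; apply/ler_addgt0Pr => e e0.
pose D k := [set t | k.+1%:R * e <= h t].
pose s N t := \sum_(0 <= k < N) e * \1_(D k) t.
have mD k : measurable (D k).
  have -> : D k = setT `&` h @^-1` `[k.+1%:R * e, +oo[.
    by apply/seteqP; split => t /=; rewrite in_itv/= andbT; [split|case].
  by apply: mh => //; exact: measurable_itv.
have sN N : [/\ finite_set (range (s N)), P.-integrable setT (EFin \o s N) &
    simple_integral m (s N) <= \int[P]_t s N t].
  elim: N => [|N [fs is_ le_s]].
    have -> : s 0%N = fun=> 0 by apply/funext => t; rewrite /s big_nil.
    split; first exact: finite_range_cst.
      exact: finite_measure_integrable_cst.
    by rewrite simple_integral_cst// Rintegral_cst// mul0r.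
  have sE : s N.+1 = fun t => s N t + e * \1_(D N) t.
    by apply/funext => t; rewrite /s big_nat_recr.
  have fD := @finite_range_indic R T (D N).
  have feD : finite_set (range (fun t => e * \1_(D N) t)).
    exact: (finite_range_op (fun x _ => e * x) fD fD).
  have i1 : P.-integrable setT (EFin \o (\1_(D N) : T -> R)).
    apply: (bounded_probability_integrable _ (C := 1)) => [|t].
      exact: measurable_indic.
    by rewrite indicE ger0_norm// lern1 leq_b1.
  have ie : P.-integrable setT (EFin \o (fun t => e * \1_(D N) t)).
    exact: (integrableZl _ e i1).
  rewrite sE; split; first exact: (finite_range_op +%R).
    exact: (integrableD _ is_ ie).
  rewrite simple_integralD// RintegralD// lerD//.
  rewrite simple_integralZ// RintegralZl// ler_pM2l//.
  rewrite simple_integral_indic// /Rintegral integral_indic// setIT.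
  exact: mPh.
(* As [h <= B], no level beyond the [N]-th is reached, and [s N] is [h] rounded down to a multiple
   of [e]. *)
pose N := Num.truncn (B / e).
have [fs is_ le_s] := sN N.
have sE t : s N t = e * (Num.truncn (h t / e))%:R.
  rewrite /s -mulr_sumr; congr (_ * _).
  rewrite -(@sum_lt_nat R _ N); last first.
    by apply: le_truncn; rewrite ler_pM2r ?invr_gt0.
  apply: eq_bigr => k _; rewrite indicE truncn_gt_nat ler_pdivlMr//.
  by congr (nat_of_bool _)%:R; apply/idP/idP; rewrite inE.
have q0 t : 0 <= h t / e by rewrite divr_ge0// ltW.
have sh t : s N t <= h t <= s N t + e.
  rewrite sE; have /andP[] := truncn_itv (q0 t).
  rewrite -natr1 ler_pdivlMr// ltr_pdivrMr// => h1 h2.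
  by apply/andP; split; lra.
have h_s : `|fa_integral m h - simple_integral m (s N)| <= e.
  apply: fa_integral_approx => // t.
  by have /andP[h1 h2] := sh t; rewrite ger0_norm; lra.
have s_h : \int[P]_t s N t <= \int[P]_t h t.
  apply: le_Rintegral => //; last by move=> t _; have /andP[] := sh t.
  by apply: (bounded_probability_integrable _ (C := B)) => // t; rewrite ger0_norm.
by move: h_s; rewrite ler_norml => /andP[_]; lra.
Qed.

(** * The topology of pointwise convergence on the family *)

Lemma continuous_borel_measurable (R : realType) (T : topologicalType) (t0 : T)
    (h : T -> R) : continuous h ->
  measurable_fun setT (h : borel_type t0 -> R).
Proof.
move=> /continuousP ch.
apply: (measurability _ (RGenOpens.measurableE R)) => _ [_ [a [b ->] <-]].
rewrite setTI; apply: sub_sigma_algebra; apply: ch.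
exact: interval_open.
Qed.

Section Subtype.
Context {T : topologicalType} (A : set T).

(** A filter on the subtype, pushed forward along the inclusion, contains [A] and so clusters at a
    point of [A]; this point lifts back because the subtype topology is initial. *)
Lemma compact_set_type : compact A -> compact [set: set_type A].
Proof.
move=> cA G PG _.
have GA : (set_val @ G) A.
  by apply: (@filterS _ G _ setT) => [t _|]; [exact: set_valP|exact: filterT].
have [p [Ap pG]] := cA (set_val @ G) _ GA.
pose q : set_type A := SigSub (mem_set Ap).
exists q; split=> // B N GB [_ [[W oW <-] Wq] WN].
have GvB : (set_val @ G) (set_val @` B).
  by apply: (@filterS _ G _ B) => // b Bb; exists b.
have Wp : nbhs p W by apply: open_nbhs_nbhs.
have [_ [[b Bb <-] Wb]] := pG _ _ GvB Wp.
by exists b; split=> //; exact: WN.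
Qed.

Lemma hausdorff_set_type : hausdorff_space T -> hausdorff_space (set_type A).
Proof.
move=> hT p q pq; suff : set_val p = set_val q by exact: val_inj.
apply: hT => U V Up Vq; have cv := @initial_continuous (set_type A) T set_val.
have [r [Ur Vr]] := pq _ _ (cv p U Up) (cv q V Vq).
by exists (set_val r).
Qed.

End Subtype.

Lemma closed_bounded_compact (R : realType) (X : Type) (F : set {ptws X -> R}) :
  (forall x, exists B, forall f, F f -> `|f x| <= B) -> closed F -> compact F.
Proof.
move=> /choice[B FB] clF.
pose box := [set f : {ptws X -> R} | forall x, `[- B x, B x]%classic (f x)].
apply: (subclosed_compact clF (B := box)).
  exact: (@tychonoff {classic X} (fun=> R) (fun x => `[- B x, B x]%classic)
    (fun x => @segment_compact R _ _)).
by move=> f Ff x /=; rewrite in_itv/= -ler_norml FB.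
Qed.

Lemma evaluation_continuous (R : realType) (X : Type) (F : set {ptws X -> R}) (x : X) :
  continuous (fun f : F => set_val f x).
Proof.
move=> f; apply: (@continuous_comp _ _ _ set_val (fun h : {ptws X -> R} => h x)).
  exact: initial_continuous.
exact: (@proj_continuous {classic X} (fun=> R) x (set_val f)).
Qed.

(* The binders x0 and f0 say that X and F are non-empty. A set F coerces to the
   type of its elements, which carries the relative topology. *)
Theorem corollary4 (R : realType) (X : Type) (x0 : X)
    (F : set {ptws X -> R}) (f0 : F) (hF : ptws_bounded F) (g : X -> R) :
  (summable_along F g <->
     exists (C : R) (m : set F -> R),
       [/\ 0 <= C, eval_probability m
         & forall x, `|g x| <= C * fa_integral m (fun f : F => `|set_val f x|)])
  /\
  (closed F ->
   (summable_along F g <->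
      exists (C : R) (mu : probability (borel_type f0) R),
        [/\ 0 <= C, @regular R F mu,
            forall x, mu.-integrable setT (fun f : F => (set_val f x)%:E)
          & forall x, `|g x| <= C * \int[mu]_f `|set_val (f : F) x|])).
Proof.
have evF (f : F) : F (set_val f) by exact: set_valP.
have Fb x : exists B, forall f, F f -> `|f x| <= B.
  have [B FB] := @ptws_bounded_ev R X F F f0 (fun f : F => set_val f) evF hF x.
  by exists B => f Ff; have := FB (SigSub (mem_set Ff)).
have m_exists : summable_along F g -> exists (C : R) (m : set F -> R),
    [/\ 0 <= C, fa_probability m &
      forall x, `|g x| <= C * fa_integral m (fun f : F => `|set_val f x|)].
  (* [{classic X}] equips [X] with the decidable equality that lists of points require. *)
  exact: (@summable_fa_probability R {classic X} F f0 g Fb x0).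
split; last move=> clF; split.
- move=> /m_exists[C [m [C0 mP gm]]]; exists C, m; split=> //; split=> // x.
  have [B FB] := Fb x; apply: (@bounded_fa_integrable R F m mP _ B) => f.
  exact: FB.
- move=> [C [m [C0 [mP _] gm]]].
  exact: (@fa_summable R X F F f0 (fun f => set_val f) evF m C g hF mP C0 gm).
- move=> /m_exists[C [m [C0 mP gm]]].
  have cF : compact [set: F] := compact_set_type (closed_bounded_compact Fb clF).
  have hF' : hausdorff_space F.
    apply: hausdorff_set_type; apply: (@hausdorff_product {classic X} (fun=> R)) => x.
    exact: Rhausdorff.
  pose mu := regular_extension_probability f0 mP hF' cF.
  have cnev (x : X) : continuous (fun f : F => `|set_val f x|).
    move=> f; apply: (continuous_comp (@evaluation_continuous R X F x f)).
    exact: norm_continuous.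
  exists C, mu; split=> //.
  + exact: regular_extension_regular.
  + move=> x; have [B FB] := Fb x.
    apply: (@bounded_probability_integrable R _ _ mu _ B) => [|f]; last exact: FB.
    exact: continuous_borel_measurable (@evaluation_continuous R X F x).
  + move=> x; apply: (le_trans (gm x)); rewrite ler_wpM2l//.
    have [B FB] := Fb x.
    apply: (@fa_integral_le_Rintegral R _ _ mu m _ B) => //.
    * exact: continuous_borel_measurable (cnev x).
    * move=> f; exact: FB.
    * move=> r; apply: le_closed_outer_content => //.
      exact: ((continuous_closedP _).1 (cnev x) _ (@closed_ge R r)).
- move=> [C [mu [C0 _ imu gmu]]].
  exact: (@measure_summable R X _ (borel_type f0) F f0 (fun f : F => set_val f)
    mu C g evF imu C0 gmu).
Qed.
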